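(* Let $X$ be a diffusion on $\mathbb{R}$ with no killing inside. Then Hunt's hypothesis (H) holds for $X$ if and only if $\mathring{\mathbb{R}}$ contains only reflecting shunt points, in the sense that both of the following hold: $$\mathring{\mathbb{R}}\cap \Lambda_{pr}=\{x\in \mathring{\mathbb{R}}\cap \Lambda_{pr}: x=a_n \text{ for some } n \text{ such that } y\rightarrow a_n \text{ for } y\in (a_n,b_n)\}$$ and $$\mathring{\mathbb{R}}\cap \Lambda_{pl}=\{x\in \mathring{\mathbb{R}}\cap \Lambda_{pl}: x=b_n \text{ for some } n \text{ such that } y\rightarrow b_n \text{ for } y\in (a_n,b_n)\}.$$
   Context: $X=(\Omega,\mathcal F,\mathcal F_t,X_t,\theta_t,\mathbf{P}_x)$ is a diffusion process on $\mathbb{R}$, i.e. a continuous strong Markov process on $\mathbb{R}$ with an isolated cemetery point $\Delta$ adjoined and lifetime $\zeta=\inf\{t>0:X_t=\Delta\}$. ''No killing inside'' means $\mathbf{P}_x(X_{\zeta-}\in\mathbb{R},\zeta<\infty)=0$ for every $x\in\mathbb{R}$. Hitting times. For nearly Borel $B$, $\sigma_B:=\inf\{t>0:X_t\in B\}$; $\sigma_y:=\sigma_{\{y\}}$. Write $x\rightarrow y$ if $\mathbf{P}_x(\sigma_y<\infty)>0$. Hunt's hypothesis. $B^r:=\{x:\mathbf{P}_x(\sigma_B=0)=1\}$. A set $A$ is polar if there is a nearly Borel $B\supset A$ with $\mathbf{P}_x(\sigma_B<\infty)=0$ for all $x$ in the state space; thin if there is a nearly Borel $B\supset A$ with $B^r=\emptyset$;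 semi-polar if it is contained in a countable union of thin sets. Hypothesis (H): every semi-polar set is polar. Classification of points. For $x\in\mathbb{R}$ let $\sigma_{x+}:=\inf\{t>0:X_t>x\}$, $\sigma_{x-}:=\inf\{t>0:X_t<x\}$ and $e^{\pm}=e^\pm(x):=\mathbf{P}_x(\sigma_{x\pm}=0)\in\{0,1\}$ (Blumenthal 0-1 law). The point $x$ is: regular ($x\in\Lambda_2$) if $e^+=e^-=1$; left shunt ($x\in\Lambda_{pl}$) if $e^+=0,e^-=1$; right shunt ($x\in\Lambda_{pr}$) if $e^-=0,e^+=1$; a trap ($x\in\Lambda_t$) if $e^+=e^-=0$. The set $\Lambda_2$ is open, and $\Lambda_2=\bigcup_{n=1}^{N}(a_n,b_n)$, $N\le\infty$, denotes its decomposition into at most countably many disjoint open intervals (its connected components). Communicating classes. Points $a,b$ are in direct communication if $a\rightarrow b$ or $b\rightarrow a$; they communicate if $a=b$ or they are joined by a finite chain of points in which consecutive points are in direct communication. This is an equivalence relation on $\mathbb{R}$; its classes $J_k$, $k\in K$, are disjoint, each is a singleton or an interval, and at most countably many are (nondegenerate) intervals. $\mathring{J}_k$ is the interior of $J_k$ (empty if $J_k$ is a singleton), and $\mathring{\mathbb{R}}:=\bigcup_{k\in K}\mathring{J}_k$. *)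

(* Defs.v *)
(* MathComp-Analysis, over an arbitrary realType R. *)
From HB Require Import structures.
From mathcomp Require Import all_boot all_order all_algebra.
From mathcomp Require Import all_classical all_reals all_analysis.
From mathcomp Require Import measurable_realfun.
Set Implicit Arguments.
Unset Strict Implicit.
Unset Printing Implicit Defensive.
Import Order.TTheory GRing.Theory Num.Theory.
Import numFieldNormedType.Exports.
Local Open Scope classical_set_scope.
Local Open Scope ring_scope.
Local Open Scope ereal_scope.

Definition borel_cemetery (R : realType) : set_system (option R) :=
  [set Some @` B | B in [set B : set R | measurable B]].

(* The line with the isolated cemetery point None adjoined. The generators are
   the Borel subsets of the line; {None} is the complement of the largest. *)
Notation cemetery_line R := (g_sigma_algebraType (@borel_cemetery R)).

Section Paths.
Context {R : realType} {d : measure_display} {Omega : measurableType d}.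
Implicit Types (X : R -> Omega -> cemetery_line R) (F : R -> set_system Omega).

(* Processes, filtrations and shifts are indexed by R, but only their values
   at times t >= 0 are ever used. *)

Definition hitting_time X (A : set (cemetery_line R)) (w : Omega) : \bar R :=
  ereal_inf [set t%:E | t in [set t : R | (0 < t)%R /\ A (X t w)]].

Definition lifetime X : Omega -> \bar R := hitting_time X [set None].

(* The real coordinate of the path; only used before the lifetime. *)
Definition position X (w : Omega) (t : R) : R := odflt 0%R (X t w).

Definition natural_sigma X : set_system Omega :=
  <<s [set X p.1 @^-1` p.2 | p in
       [set p : R * set (cemetery_line R) | (0 <= p.1)%R /\ measurable p.2]] >>.

Definition stopping_time F (T : Omega -> \bar R) : Prop :=
  (forall w, 0 <= T w) /\
  (forall t : R, (0 <= t)%R -> F t [set w | T w <= t%:E]).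

Definition stopped_sigma F (T : Omega -> \bar R) : set_system Omega :=
  [set A | measurable A /\
    forall t : R, (0 <= t)%R -> F t (A `&` [set w | T w <= t%:E])].

End Paths.

(* [filt_right] is essential: without it the exponential holding point left
   continuously afterwards would be allowed, and Blumenthal's 0-1 law would
   fail. The sigma-algebra of Omega may be completed, hence initial-state
   measurability is only required on the sigma-algebra generated by X. *)
Record diffusion (R : realType) (d : measure_display)
    (Omega : measurableType d) := Diffusion {
  proc :> R -> Omega -> cemetery_line R ;
  filt : R -> set_system Omega ;
  shift : R -> Omega -> Omega ;
  law : cemetery_line R -> probability Omega R ;
  filt_sigma : forall t : R, (0 <= t)%R -> sigma_algebra setT (filt t) ;
  filt_measurable : forall t : R, (0 <= t)%R -> filt t `<=` measurable ;
  filt_mono : forall s t : R, (0 <= s)%R -> (s <= t)%R -> filt s `<=` filt t ;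
  filt_right : forall t : R, (0 <= t)%R ->
    filt t = \bigcap_(s in [set s | (t < s)%R]) filt s ;
  proc_adapted : forall t : R, (0 <= t)%R ->
    forall A : set (cemetery_line R), measurable A -> filt t (proc t @^-1` A) ;
  (* Both absorption in the cemetery and right-continuity at the lifetime, the
     cemetery being isolated. *)
  proc_dead : forall (w : Omega) (t : R), (0 <= t)%R ->
    (proc t w = None <-> lifetime proc w <= t%:E) ;
  proc_continuous : forall w,
    {within [set t : R | (0 <= t)%R /\ t%:E < lifetime proc w],
     continuous (position proc w)} ;
  proc_shift : forall (s t : R) (w : Omega), (0 <= s)%R -> (0 <= t)%R ->
    proc s (shift t w) = proc (s + t)%R w ;
  law_start : forall x, law x [set w | proc 0%R w = x] = 1 ;
  law_measurable : forall A, natural_sigma proc A ->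
    measurable_fun [set: cemetery_line R] (law ^~ A) ;
  strong_markov : forall (x : cemetery_line R) (T : Omega -> \bar R)
      (L A : set Omega),
    stopping_time filt T -> stopped_sigma filt T L -> natural_sigma proc A ->
    law x [set w | [/\ L w, T w < +oo & A (shift (fine (T w)) w)]] =
    \int[law x]_(w in L `&` [set w | T w < +oo])
       law (proc (fine (T w)) w) A
}.

Section Notions.
Context {R : realType} {d : measure_display} {Omega : measurableType d}.
Variable X : diffusion R Omega.
Implicit Types (x y : R) (A B : set R).

Definition Prob x : probability Omega R := law X (Some x).

Definition sigma B : Omega -> \bar R := hitting_time X (Some @` B).

Definition no_killing_inside : Prop := forall x,
  (Prob x).-negligible [set w | [/\ 0 < lifetime X w, lifetime X w < +oo &
    exists l : R, position X w t @[t --> (fine (lifetime X w))^'-] --> l]].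

Definition reaches x y : Prop := 0 < Prob x [set w | sigma [set y] w < +oo].

(* For every initial law mu, B lies between two Borel sets whose difference is
   visited with P_mu-probability 0, where P_mu = \int P_x mu(dx). The visiting
   event need not be in the sigma-algebra generated by X, so it is only
   required to be contained in a null element of the latter. *)
Definition nearly_borel B : Prop :=
  forall mu : probability (cemetery_line R) R,
  exists B1 B2 : set R, [/\ measurable B1, measurable B2, B1 `<=` B, B `<=` B2 &
    exists N : set Omega, [/\ natural_sigma X N,
      [set w | exists t : R, (0 <= t)%R /\ (Some @` (B2 `\` B1)) (X t w)]
        `<=` N &
      \int[mu]_x law X x N = 0]].

(* Hitting events of nearly Borel sets are only measurable up to P_x-null sets,
   so probability 0 (resp. 1) is stated as negligibility (resp. almost sure
   truth), i.e. with respect to the completion of P_x. *)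

Definition regular_points B : set R :=
  [set x | {ae Prob x, forall w, sigma B w = 0}].

Definition polar A : Prop := exists B, [/\ nearly_borel B, A `<=` B &
  forall x, (Prob x).-negligible [set w | sigma B w < +oo]].

Definition thin A : Prop := exists B,
  [/\ nearly_borel B, A `<=` B & regular_points B = set0].

Definition semipolar A : Prop := exists C : (set R)^nat,
  (forall n, thin (C n)) /\ A `<=` \bigcup_n C n.

Definition hunt_H : Prop := forall A, semipolar A -> polar A.

Definition e_plus x : \bar R := Prob x [set w | sigma [set y | (x < y)%R] w = 0].
Definition e_minus x : \bar R := Prob x [set w | sigma [set y | (y < x)%R] w = 0].

Definition Lambda2 : set R := [set x | e_plus x = 1 /\ e_minus x = 1].
Definition Lambda_pl : set R := [set x | e_plus x = 0 /\ e_minus x = 1].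
Definition Lambda_pr : set R := [set x | e_minus x = 0 /\ e_plus x = 1].

(* ]a, b[, with possibly infinite endpoints, is one of the intervals
   (a_n, b_n) composing the open set Lambda2. *)
Definition Lambda2_component (a b : \bar R) : Prop :=
  exists2 c, Lambda2 c &
    connected_component Lambda2 c = [set y : R | a < y%:E < b].

Definition direct_comm : rel R := fun x y => `[< reaches x y \/ reaches y x >].

Definition communicate x y : Prop :=
  exists2 s : seq R, path direct_comm x s & last x s = y.

(* The union over all classes of their interiors; a class is indexed by any of
   its points. *)
Definition inner_line : set R := \bigcup_x interior [set y | communicate x y].

End Notions.

(* Main.v *)
Require Import Defs.
From mathcomp Require Import all_boot all_order all_algebra.
From mathcomp Require Import all_classical all_reals all_analysis.
From mathcomp Require Import measurable_realfun.
Set Implicit Arguments.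
Unset Strict Implicit.
Unset Printing Implicit Defensive.
Import Order.TTheory GRing.Theory Num.Theory.
Import numFieldNormedType.Exports.
Local Open Scope classical_set_scope.
Local Open Scope ring_scope.
Local Open Scope ereal_scope.

(* Call x self-regular when a path started at x returns to x immediately, i.e.
   P_x(sigma_x = 0) = 1; by the 0-1 law the alternative is probability 0, and
   then {x} is thin. Regular points and traps are self-regular, so only shunt
   points x matter. Such an x is a one-way door: say no path crosses from x to
   its left. If x is inside a communicating class, some y < x reaches x, so {x}
   is not polar and (H) forces self-regularity; the excursions of x to the right
   then return to x, which makes every point of some (x, y) regular with a path
   back to x, and connectedness spreads this to the whole component.
   Conversely, if some y > x reaches x, the probability that the path from z
   reaches x within time e stays bounded below as z decreases to x, for every
   e > 0, whence P_x(sigma_x = 0) > 0. Thus a nearly Borel set B with no regular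
   point meets the interiors of the classes nowhere. Its points are shunts that
   are endpoints of nondegenerate classes, hence countably many, and none of
   them is ever reached, so B is polar. *)

Lemma lt_EFin_dense (R : realType) (s : R) (e : \bar R) :
  s%:E < e -> exists2 r : R, (s < r)%R & r%:E < e.
Proof.
case: e => [e|_|//]; last by exists (s + 1)%R; rewrite ?ltrDl ?ltry.
by rewrite lte_fin => se; exists ((s + e) / 2)%R; rewrite ?lte_fin midf_lt.
Qed.

(** Rewriting with this equality turns closure questions about [filt] or [natural_sigma] into
    ordinary measurability goals. *)
Lemma sigma_algebraE (T : pointedType) (S : set_system T) :
  sigma_algebra setT S -> S = @measurable _ (g_sigma_algebraType S).
Proof. by move=> hS; rewrite /measurable/= sigma_algebra_id. Qed.

(** * Continuity of paths up to the lifetime, and hitting times *)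

Section Paths.
Context {R : realType} {d : measure_display} {Omega : measurableType d}.
Variable X : diffusion R Omega.
Implicit Types (B U : set R) (x y z s t u : R) (v : \bar R) (w : Omega).

(** The time window is open at both ends. Thus [hits B 0 v] is exactly the event that the hitting
    time is below [v], and a visit can be moved slightly in time to a rational instant of the
    window. *)
Definition hits B u v : set Omega :=
  [set w | exists t, [/\ (u < t)%R, t%:E < v & (Some @` B) (X t w)]].

Lemma alive_lt_lifetime s w y : (0 <= s)%R -> X s w = Some y -> s%:E < lifetime X w.
Proof.
by move=> s0 Xs; rewrite ltNge; apply/negP => /(proc_dead X w s0); rewrite Xs.
Qed.

Lemma lt_lifetime_alive s w : (0 <= s)%R -> s%:E < lifetime X w ->
  X s w = Some (position X w s).
Proof.
move=> s0 sl; rewrite /position; case Xs: (X s w) => [//|].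
by move/(proc_dead X w s0): Xs; rewrite leNgt sl.
Qed.

(** The conclusion also says that the path is alive at all times near [s]: since [s] lies strictly
    below the lifetime, so does a whole neighbourhood of it. With [U] the full line this is a pure
    survival statement. *)
Lemma path_cont s w y U : (0 <= s)%R -> X s w = Some y -> nbhs y U ->
  exists2 e, (0 < e)%R &
    forall t, (0 <= t)%R -> (`|t - s| < e)%R -> (Some @` U) (X t w).
Proof.
move=> s0 Xs yU; have sl := alive_lt_lifetime s0 Xs.
have [r sr rl] := lt_EFin_dense sl.
have /subspace_continuousP/(_ s (conj s0 sl)) cX := @proc_continuous _ _ _ X w.
have yp : y = position X w s by rewrite /position Xs.
rewrite yp in yU; have := cX _ yU.
rewrite /= /within/= => -[e /= e0 He].
exists (Num.min e (r - s)%R); first by rewrite lt_min e0 subr_gt0.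
move=> t t0; rewrite lt_min => /andP[te tr].
have tl : t%:E < lifetime X w.
  apply: lt_trans rl; rewrite lte_fin -(ltrD2r (- s)).
  by apply: le_lt_trans tr; exact: ler_norm.
exists (position X w t); last by rewrite (lt_lifetime_alive t0 tl).
by apply: He; rewrite //= distrC.
Qed.

Lemma path_continuous_itv w (a b : R) y : (0 <= a)%R -> X b w = Some y ->
  {within `[a, b], continuous (position X w)}.
Proof.
move=> a0 Xb; have [|ba] := leP a b; last first.
  have -> : `[a, b]%classic = set0 by rewrite set_itv_ge// bnd_simp -ltNge.
  by apply/subspace_continuousP.
move=> ab; have b0 : (0 <= b)%R by exact: le_trans ab.
apply: continuous_subspaceW (@proc_continuous _ _ _ X w) => t /=.
rewrite in_itv/= => /andP[at_ tb]; split; first exact: le_trans at_.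
by apply: le_lt_trans (alive_lt_lifetime b0 Xb); rewrite lee_fin.
Qed.

Lemma path_alive (a b : R) w y : (0 <= a <= b)%R -> X b w = Some y ->
  X a w = Some (position X w a).
Proof.
move=> /andP[a0 ab] Xb; apply: lt_lifetime_alive => //.
apply: le_lt_trans (alive_lt_lifetime (le_trans a0 ab) Xb).
by rewrite lee_fin.
Qed.

(** The cemetery is absorbing, so being alive at [b] makes the path real and continuous on all of
    [a, b], where the intermediate value theorem applies. *)
Lemma path_IVT (a b : R) w x y z : (0 <= a)%R -> (a < b)%R ->
  X a w = Some x -> X b w = Some y ->
  (x < z < y)%R \/ (y < z < x)%R ->
  exists t, [/\ (a < t)%R, (t < b)%R & X t w = Some z].
Proof.
move=> a0 ab Xa Xb xzy.
have pa : position X w a = x by rewrite /position Xa.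
have pb : position X w b = y by rewrite /position Xb.
have [||c] := @IVT R (position X w) a b z (ltW ab).
- exact: path_continuous_itv Xb.
- rewrite pa pb ge_min le_max.
  by case: xzy => /andP[/ltW -> /ltW ->]; rewrite ?orbT.
rewrite in_itv/= => /andP[ac cb] pc.
exists c; split.
- rewrite lt_neqAle ac andbT; apply/eqP => ac'; move: xzy.
  by rewrite -ac' in pc; rewrite -pc pa !ltxx andbF => -[].
- rewrite lt_neqAle cb andbT; apply/eqP => bc; move: xzy.
  by rewrite bc in pc; rewrite -pc pb !ltxx andbF => -[].
- by rewrite -pc; apply: path_alive Xb; rewrite (le_trans a0)//= .
Qed.

Lemma hitsS B B' u u' v v' : B `<=` B' -> (u' <= u)%R -> v <= v' ->
  hits B u v `<=` hits B' u' v'.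
Proof.
move=> BB' uu vv w [t [ut tv BX]]; exists t; split.
- exact: le_lt_trans ut.
- exact: lt_le_trans vv.
- by case: BX => b Bb <-; exists b => //; exact: BB'.
Qed.

Lemma hitting_ltP B v w : sigma X B w < v <-> hits B 0 v w.
Proof.
split=> [/ereal_inf_lt[_ [t [t0 Bt] <-] tv]|[t [t0 tv Bt]]]; first by exists t.
by apply: le_lt_trans tv; apply: ereal_inf_lbound; exists t.
Qed.

Lemma hitting_ge0 B w : 0 <= sigma X B w.
Proof. by apply: le_ereal_inf_tmp => _ [t [t0 _] <-]; rewrite lee_fin ltW. Qed.

Lemma hitting_eq0P B w :
  sigma X B w = 0 <-> forall e, (0 < e)%R -> hits B 0 e%:E w.
Proof.
split=> [s0 e e0|H]; first by apply/hitting_ltP; rewrite s0 lte_fin.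
apply/eqP; rewrite eq_le hitting_ge0 andbT; apply/lee_addgt0Pr => e e0.
by rewrite add0e; apply/ltW/hitting_ltP/H.
Qed.

Lemma hits_shift B u v s w : (0 <= s)%R -> (0 <= u)%R ->
  hits B u v (Defs.shift X s w) <-> hits B (s + u) (s%:E + v) w.
Proof.
move=> s0 u0; split=> [[t [ut tv Bt]]|[t [ut tv Bt]]].
  have t0 : (0 <= t)%R by rewrite (le_trans u0)// ltW.
  exists (t + s)%R; split; first by rewrite addrC ltrD2r.
    by rewrite addrC EFinD lteD2lE.
  by rewrite -proc_shift.
exists (t - s)%R; split; first by rewrite ltrBrDl.
  by rewrite EFinB lteBlDl.
by rewrite proc_shift ?subrK// subr_ge0 -(lerD2r u) ler_wpDr// ltW.
Qed.

End Paths.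

(** * Measurability of hitting events of open sets and points *)

Section Measurability.
Context {R : realType} {d : measure_display} {Omega : measurableType d}.
Variable X : diffusion R Omega.
Implicit Types (B U : set R) (x y z s t u : R) (v : \bar R) (w : Omega).

Lemma measurable_Some B :
  measurable B -> measurable (Some @` B : set (cemetery_line R)).
Proof. by move=> mB; apply: sub_sigma_algebra; exists B. Qed.

(** A visit to an open set lasts for a short while, so it can be observed at a rational time just
    after it, still inside the window. *)
Lemma hits_open_sigma (S : set_system Omega) B u v :
  sigma_algebra setT S -> (0 <= u)%R -> open B ->
  (forall q (A : set (cemetery_line R)), (u < q)%R -> q%:E < v ->
     measurable A -> S (X q @^-1` A)) ->
  S (hits X B u v).
Proof.
move=> hS u0 oB SX.
have -> : hits X B u v = \bigcup_(q : rat)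
    (if ((u < ratr q)%R && ((ratr q)%:E < v)) then X (ratr q) @^-1` (Some @` B)
     else set0).
  apply/seteqP; split=> [w [t [ut tv [b Bb Xt]]]|w [q _]]; last first.
    by case: ifPn => // /andP[uq qv] BX; exists (ratr q).
  have t0 : (0 <= t)%R by rewrite (le_trans u0)// ltW.
  have [r tr rv] := lt_EFin_dense tv.
  have [e e0 He] := path_cont t0 (esym Xt) (open_nbhs_nbhs (conj oB Bb)).
  have /rat_in_itvoo[q] : (t < Num.min r (t + e))%R by rewrite lt_min tr ltrDl.
  rewrite in_itv/= lt_min => /and3P[tq qr qe]; exists q => //.
  rewrite (lt_trans ut tq) (lt_trans _ rv) ?lte_fin//=.
  apply: He; first by rewrite (le_trans t0)// ltW.
  by rewrite ger0_norm ?subr_ge0 ?(ltW tq)// ltrBlDl.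
have := SX; rewrite (sigma_algebraE hS) => {}SX.
apply: bigcupT_measurable_rat => q; case: ifPn => // /andP[uq qv].
by apply: SX => //; apply: measurable_Some; exact: open_measurable.
Qed.

(** A visit to [x] is a time interval with rational ends, at whose end the path is still alive,
    during which rational times bring the path arbitrarily close to [x]. Conversely, compactness of
    that interval turns arbitrary closeness into an actual visit. *)
Lemma hits_point_sigma (S : set_system Omega) x u v :
  sigma_algebra setT S -> (0 <= u)%R ->
  (forall q (A : set (cemetery_line R)), (u < q)%R -> q%:E < v ->
     measurable A -> S (X q @^-1` A)) ->
  S (hits X [set x] u v).
Proof.
move=> hS u0 SX.
have -> : hits X [set x] u v = \bigcup_(a : rat) \bigcup_(b : rat)
    (if [&& (u < ratr a)%R, (ratr a <= ratr b :> R)%R & (ratr b)%:E < v]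
     then X (ratr b) @^-1` (Some @` setT) `&`
       \bigcap_n \bigcup_(p : rat)
         (if (ratr a <= (ratr p : R) <= ratr b)%R
          then X (ratr p) @^-1` (Some @` (ball x n.+1%:R^-1)) else set0)
     else set0).
  apply/seteqP; split=> [w [t [ut tv [_ -> Xt]]]|w [a _ [b _]]].
    have t0 : (0 <= t)%R by rewrite (le_trans u0)// ltW.
    have [r tr rv] := lt_EFin_dense tv.
    have [e e0 He] := path_cont t0 (esym Xt) filterT.
    have /rat_in_itvoo[a] := ut; rewrite in_itv/= => /andP[ua at_].
    have /rat_in_itvoo[b] : (t < Num.min r (t + e))%R by rewrite lt_min tr ltrDl.
    rewrite in_itv/= lt_min => /and3P[tb br be].
    exists a => //; exists b => //.
    rewrite ua (ltW (lt_trans at_ tb)) (lt_trans _ rv) ?lte_fin//=; split.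
      apply: He; first by rewrite (le_trans t0)// ltW.
      by rewrite ger0_norm ?subr_ge0 ?(ltW tb)// ltrBlDl.
    move=> n _.
    have n0 : (0 < n.+1%:R^-1 :> R)%R by rewrite invr_gt0.
    have [e' e'0 He'] := path_cont t0 (esym Xt) (nbhsx_ballx x _ n0).
    have /rat_in_itvoo[p] : (t < Num.min (ratr b) (t + e'))%R.
      by rewrite lt_min tb ltrDl.
    rewrite in_itv/= lt_min => /and3P[tp pb pe].
    exists p => //; rewrite (ltW pb) (ltW (lt_trans at_ tp)) /=.
    apply: He'; first by rewrite (le_trans t0)// ltW.
    by rewrite ger0_norm ?subr_ge0 ?(ltW tp)// ltrBlDl.
  case: ifPn => // /and3P[ua ab bv] [[y _ Xb] H].
  have a0 : (0 <= ratr a :> R)%R by rewrite (le_trans u0)// ltW.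
  have cf : {within `[(ratr a : R), ratr b]%classic,
      continuous (fun t => `|position X w t - x|%R)}.
    have /subspace_continuousP cX := path_continuous_itv a0 (esym Xb).
    apply/subspace_continuousP => t tab.
    by apply: cvg_norm; apply: cvgB; [exact: cX|exact: cvg_cst].
  (* The distance to [x] attains its minimum at [c]; a positive minimum would keep all rational
     times out of some ball around [x]. *)
  have [c] := EVT_min ab cf; rewrite in_itv/= => /andP[ac cb] Hc.
  have aliveX t : (ratr a <= t <= ratr b)%R -> X t w = Some (position X w t).
    move=> /andP[at_ tb]; apply: path_alive (esym Xb).
    by rewrite (le_trans a0 at_).
  exists c; split; first exact: lt_le_trans ac.
    by apply: le_lt_trans bv; rewrite lee_fin.
  exists (position X w c); last by rewrite aliveX ?ac.
  apply/eqP; rewrite -subr_eq0 -normr_le0 leNgt; apply/negP => /ltr_add_invr[n].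
  rewrite add0r => Hn; have [p _] := H n I.
  case: ifPn => // pab [z zB Xp].
  have : z = position X w (ratr p) by rewrite /position -Xp.
  move=> zp; have := Hc _ pab; rewrite -zp leNgt => /negP; apply.
  by apply: lt_trans Hn; rewrite distrC.
have := SX; rewrite (sigma_algebraE hS) => {}SX.
apply: bigcupT_measurable_rat => a; apply: bigcupT_measurable_rat => b.
case: ifPn => // /and3P[ua ab bv]; apply: measurableI.
  apply: SX => //; first exact: lt_le_trans ab.
  by apply: measurable_Some; exact: measurableT.
apply: bigcapT_measurable => n; apply: bigcupT_measurable_rat => p.
case: ifPn => // /andP[ap pb]; apply: SX; first exact: lt_le_trans ap.
  by apply: le_lt_trans bv; rewrite lee_fin.
by apply: measurable_Some; apply: open_measurable; exact: ball_open.
Qed.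

(** Half-lines and singletons are the sets whose hitting probabilities enter the argument; for these
    two shapes countable operations give measurability, without a general debut theorem. *)
Definition open_or_point B := open B \/ exists x, B = [set x].

Lemma hits_sigma (S : set_system Omega) B u v :
  sigma_algebra setT S -> (0 <= u)%R -> open_or_point B ->
  (forall q (A : set (cemetery_line R)), (u < q)%R -> q%:E < v ->
     measurable A -> S (X q @^-1` A)) ->
  S (hits X B u v).
Proof.
move=> hS u0 [oB|[x ->]]; first exact: hits_open_sigma.
exact: hits_point_sigma.
Qed.

Lemma natural_sigma_algebra : sigma_algebra setT (natural_sigma X).
Proof. exact: smallest_sigma_algebra. Qed.

Lemma natural_preimage t (A : set (cemetery_line R)) :
  (0 <= t)%R -> measurable A -> natural_sigma X (X t @^-1` A).
Proof. by move=> t0 mA; apply: sub_sigma_algebra; exists (t, A). Qed.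

Lemma natural_measurable A : natural_sigma X A -> measurable A.
Proof.
move: A; apply: smallest_sub.
  by split=> [//|A mA|F mF]; [exact: measurableD|exact: bigcup_measurable].
move=> _ [[t A] [/= t0 mA] <-].
by apply: (filt_measurable t0); exact: proc_adapted.
Qed.

Lemma natural_hits B u v :
  (0 <= u)%R -> open_or_point B -> natural_sigma X (hits X B u v).
Proof.
move=> u0 gB; apply: hits_sigma => //; first exact: natural_sigma_algebra.
move=> q A uq _ mA; apply: natural_preimage => //.
by rewrite (le_trans u0)// ltW.
Qed.

Lemma measurable_hits B u v :
  (0 <= u)%R -> open_or_point B -> measurable (hits X B u v).
Proof. by move=> u0 gB; apply: natural_measurable; exact: natural_hits. Qed.

Lemma filt_hits B u v t : (0 <= u)%R -> (0 <= t)%R -> v <= t%:E ->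
  open_or_point B -> filt X t (hits X B u v).
Proof.
move=> u0 t0 vt gB; apply: hits_sigma => //; first exact: filt_sigma.
move=> q A uq qv mA.
have q0 : (0 <= q)%R by rewrite (le_trans u0)// ltW.
apply: (@filt_mono _ _ _ X q t) => //; last exact: proc_adapted.
by rewrite -lee_fin (le_trans (ltW qv)).
Qed.

(** The event that the hitting time is at most [t] is the limit of the events that it is below t +
    1/(n+1), hence known at every time s > t; right-continuity of the filtration brings it down to
    [t]. The minimum with [s] keeps every term in [filt X s]. *)
Lemma hitting_stopping B : open_or_point B -> stopping_time (filt X) (sigma X B).
Proof.
move=> gB; split=> [w|t t0]; first exact: hitting_ge0.
rewrite filt_right// => s /= ts.
have s0 : (0 <= s)%R by rewrite (le_trans t0)// ltW.
have -> : [set w | sigma X B w <= t%:E] =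
    \bigcap_n hits X B 0 (Num.min (t + n.+1%:R^-1) s)%:E.
  apply/seteqP; split=> w /= H.
    move=> n _; apply/hitting_ltP; apply: le_lt_trans H _.
    by rewrite lte_fin lt_min ts ltrDl invr_gt0 ltr0n.
  apply/lee_addgt0Pr => e e0.
  have /ltr_add_invr[n] := e0; rewrite add0r => ne.
  have /hitting_ltP/ltW/le_trans := H n I; apply.
  by rewrite -EFinD lee_fin ge_min lerD2l (ltW ne).
have mh n : filt X s (hits X B 0 (Num.min (t + n.+1%:R^-1) s)%:E).
  by apply: filt_hits => //; rewrite lee_fin ge_min lexx orbT.
move: mh; rewrite (sigma_algebraE (filt_sigma X s0)) => mh.
by apply: bigcapT_measurable => n; exact: mh.
Qed.

Lemma hitting_eq0E B : [set w | sigma X B w = 0] = [set w | sigma X B w <= 0].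
Proof.
apply/seteqP; split=> [w /= ->//|w /= s0].
by apply/eqP; rewrite eq_le s0 hitting_ge0.
Qed.

Lemma filt_hitting_eq0 B : open_or_point B ->
  filt X 0 [set w | sigma X B w = 0].
Proof. by move=> gB; rewrite hitting_eq0E; apply: (hitting_stopping gB).2. Qed.

Lemma natural_hitting_eq0 B : open_or_point B ->
  natural_sigma X [set w | sigma X B w = 0].
Proof.
move=> gB.
have -> : [set w | sigma X B w = 0] = \bigcap_n hits X B 0 n.+1%:R^-1%:E.
  apply/seteqP; split=> w /=.
    by move=> /hitting_eq0P H n _; apply: H; rewrite invr_gt0.
  move=> H; apply/hitting_eq0P => e e0.
  have /ltr_add_invr[n] := e0; rewrite add0r => ne.
  apply: hitsS (H n I) => //; by rewrite lee_fin ltW.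
have mh n : natural_sigma X (hits X B 0 n.+1%:R^-1%:E) by exact: natural_hits.
move: mh; rewrite (sigma_algebraE natural_sigma_algebra) => mh.
by apply: bigcapT_measurable => n; exact: mh.
Qed.

Lemma measurable_hitting_eq0 B : open_or_point B ->
  measurable [set w | sigma X B w = 0].
Proof. by move=> gB; apply: natural_measurable; exact: natural_hitting_eq0. Qed.

Lemma stopping_le_measurable (T : Omega -> \bar R) t :
  stopping_time (filt X) T -> measurable [set w | T w <= t%:E].
Proof.
move=> [T0 fT]; have [t0|t0] := leP 0%R t.
  by apply: (filt_measurable t0); exact: fT.
rewrite [X in measurable X](_ : _ = set0)//; apply/seteqP; split=> // w /=.
by apply/negP; rewrite -ltNge; apply: lt_le_trans (T0 w); rewrite lte_fin.
Qed.

Lemma stopping_fin_measurable (T : Omega -> \bar R) :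
  stopping_time (filt X) T -> measurable [set w | T w < +oo].
Proof.
move=> sT; rewrite [X in measurable X](_ : _ =
    \bigcup_n [set w | T w <= n%:R%:E]).
  by apply: bigcupT_measurable => n; exact: stopping_le_measurable.
apply/seteqP; split=> [w /=|w [n _] /= /le_lt_trans]; last by apply; rewrite ltry.
have := sT.1 w; case Tw: (T w) => [r||//]; last by rewrite ltxx.
rewrite lee_fin => r0 _.
by exists (Num.bound r) => //; rewrite /= Tw lee_fin ltW// archi_boundP.
Qed.

Definition hits_after (T : Omega -> \bar R) B v : set Omega :=
  [set w | T w < +oo /\ hits X B 0 v (Defs.shift X (fine (T w)) w)].

(** The shift is not assumed measurable, so the event is rewritten without it. For a finite delay r,
    a visit at time t with T < t < T + r is separated from both bounds by rationals a and b, so that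
    T <= a < t < b < T + r; an infinite delay is a union of finite ones. *)
Lemma measurable_hits_after (T : Omega -> \bar R) B v : open_or_point B ->
  stopping_time (filt X) T -> measurable (hits_after T B v).
Proof.
move=> gB sT; wlog [r ->] : v / exists r : R, v = r%:E => [H|].
  case: v => [r||]; first by apply: H; exists r.
    have -> : hits_after T B +oo = \bigcup_n hits_after T B n%:R%:E.
      apply/seteqP; split=> [w [Ty [t [t0 _ Bt]]]|w [n _ [Ty [t [t0 _ Bt]]]]].
        exists (Num.bound t) => //; split=> //; exists t; split => //.
        by rewrite lte_fin archi_boundP// ltW.
      by split=> //; exists t; split=> //; rewrite ltry.
    by apply: bigcupT_measurable => n; apply: H; exists n%:R.
  rewrite [X in measurable X](_ : _ = set0)//.
  by apply/seteqP; split=> // w [_ [t [_]]]; rewrite ltNge leNye.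
rewrite [X in measurable X](_ : _ = \bigcup_(a : rat) \bigcup_(b : rat)
  (if (0 <= ratr a :> R)%R then
   [set w | T w <= (ratr a)%:E] `&` ~` [set w | T w <= (ratr b - r)%:E]
    `&` hits X B (ratr a) (ratr b)%:E else set0)).
  apply: bigcupT_measurable_rat => a; apply: bigcupT_measurable_rat => b.
  case: ifPn => // a0; apply: measurableI; last exact: measurable_hits.
  apply: measurableI; first exact: stopping_le_measurable.
  by apply: measurableC; exact: stopping_le_measurable.
have finT w : T w < +oo -> exists2 T', (0 <= T')%R & T w = T'%:E.
  have := sT.1 w; case: (T w) => [T'||//]; last by rewrite ltxx.
  by rewrite lee_fin => T'0 _; exists T'.
apply/seteqP; split=> w.
  move=> [/finT[T' T'0 TE]]; rewrite TE /=.
  move=> /hits_shift-/(_ T'0 (lexx _))[t []]; rewrite addr0 => Tt tv Bt.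
  have /rat_in_itvoo[a] := Tt; rewrite in_itv/= => /andP[Ta at_].
  move: tv; rewrite -EFinD lte_fin => /rat_in_itvoo[b].
  rewrite in_itv/= => /andP[tb bT].
  exists a => //; exists b => //; rewrite (le_trans T'0 (ltW Ta)); split.
    rewrite /= TE !lee_fin ltW//; split=> //; apply/negP.
    by rewrite -ltNge ltrBlDr.
  by exists t; rewrite lte_fin.
move=> [a _ [b _]]; case: ifPn => // a0 [[/= Ta /negP]].
have Ty := le_lt_trans Ta (ltry _); have [T' T'0 TE] := finT _ Ty.
rewrite TE lee_fin in Ta; rewrite TE -ltNge lte_fin ltrBlDr => bT [t [at_ tb Bt]].
split=> //; rewrite TE /=; apply/hits_shift => //.
exists t; rewrite addr0 (le_lt_trans Ta)//.
by split=> //; apply: lt_trans tb _; rewrite -EFinD lte_fin.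
Qed.

End Measurability.

(** * The strong Markov property, the 0-1 law and reachability *)

Section Markov.
Context {R : realType} {d : measure_display} {Omega : measurableType d}.
Variable X : diffusion R Omega.
Implicit Types (B U : set R) (r x y z s t u : R) (v : \bar R) (w : Omega).
Implicit Types (A L : set Omega) (T : Omega -> \bar R).

(* The sign s, always nonzero, orients the line: [side s x] is the open half-line
   right of x for s > 0 and left of x for s < 0, so that statements about the two
   sides are proved once. *)
Definition side s x : set R := [set y | (s * x < s * y)%R].

Definition btw x z y : Prop := (x < z < y)%R \/ (y < z < x)%R.

Lemma side_btw s x z y : s != 0%R -> side s x z -> side s z y -> btw x z y.
Proof.
rewrite /side /btw/= neq_lt => /orP[s0|s0].
  by rewrite !ltr_nM2l// => zx yz; right; rewrite yz.
by rewrite !ltr_pM2l// => xz zy; left; rewrite xz.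
Qed.

Lemma btw_side s x u y : s != 0%R -> side s x y -> btw x u y ->
  side s x u /\ side s u y.
Proof.
rewrite /side /btw/= neq_lt => /orP[s0|s0].
  rewrite !ltr_nM2l// => yx [] /andP[h1 h2]; last by rewrite h1 h2.
  by have := lt_trans yx (lt_trans h1 h2); rewrite ltxx.
rewrite !ltr_pM2l// => xy [] /andP[h1 h2]; first by rewrite h1 h2.
by have := lt_trans xy (lt_trans h1 h2); rewrite ltxx.
Qed.

Lemma side_total s x y : s != 0%R -> [\/ y = x, side s x y | side (- s) x y].
Proof.
move=> s0; rewrite /side/= !mulNr ltrN2.
have [h|h|/(mulfI s0)h] := ltgtP (s * x)%R (s * y)%R.
- exact: Or32.
- exact: Or33.
- exact: Or31.
Qed.

Lemma side_asym s x y : side s x y -> side (- s) x y -> False.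
Proof. by rewrite /side/= !mulNr ltrN2 => /lt_trans/[apply]; rewrite ltxx. Qed.

Lemma side_trans s x y z : side s x y -> side s y z -> side s x z.
Proof. exact: lt_trans. Qed.

Lemma side_irr s x : ~ side s x x.
Proof. by rewrite /side/= ltxx. Qed.

Lemma sideN s x y : side (- s) x y <-> side s y x.
Proof. by rewrite /side/= !mulNr ltrN2. Qed.

Lemma open_side s x : open (side s x).
Proof.
have -> : side s x = ( *%R s) @^-1` [set y | (s * x < y)%R] by [].
by apply: open_comp; [move=> y _; exact: mulrl_continuous|exact: open_gt].
Qed.

Lemma good_side s x : open_or_point (side s x).
Proof. by left; exact: open_side. Qed.

Lemma good_point x : open_or_point [set x].
Proof. by right; exists x. Qed.

Hint Resolve good_side good_point : core.

Lemma hitting_finE B w : sigma X B w < +oo ->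
  exists2 r, (0 <= r)%R & sigma X B w = r%:E.
Proof.
have := hitting_ge0 X B w; case: sigma => [r||//]; last by rewrite ltxx.
by rewrite lee_fin => r0 _; exists r.
Qed.

Lemma hitting_witness B w r e : sigma X B w = r%:E -> (0 < e)%R ->
  exists t, [/\ (0 < t)%R, (r <= t)%R, (t < r + e)%R & (Some @` B) (X t w)].
Proof.
move=> sr e0; have : sigma X B w < (r + e)%:E by rewrite sr lte_fin ltrDl.
move=> /hitting_ltP[t [t0 te Bt]]; exists t; split => //.
by rewrite -lee_fin -sr; apply: ereal_inf_lbound; exists t.
Qed.

Lemma hitting_fin_alive B w r : sigma X B w = r%:E -> (0 <= r)%R ->
  X r w = Some (position X w r).
Proof.
move=> sr r0; have [t [t0 rt _ [b _ Xt]]] := hitting_witness sr ltr01.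
by apply: path_alive (esym Xt); rewrite r0.
Qed.

(** If the path were off [y] at the infimum, continuity would keep it off [y] for some time
    afterwards, leaving no visits close to the infimum. *)
Lemma hitting_point y w : sigma X [set y] w < +oo ->
  X (fine (sigma X [set y] w)) w = Some y.
Proof.
move=> /hitting_finE[r r0 sr]; rewrite sr /=.
have Xr := hitting_fin_alive sr r0; rewrite Xr; congr Some.
apply: contrapT => py.
have [e e0 He] := path_cont r0 Xr (open_nbhs_nbhs (conj (closed_openC (@closed_eq R y)) py)).
have [t [t0 rt te [_ -> Xt]]] := hitting_witness sr e0.
have [] := He t (ltW t0); first by rewrite ger0_norm ?subr_ge0// ltrBlDl.
by move=> z zy; rewrite -Xt => -[].
Qed.

(** At the entrance time the path cannot be strictly on side [s], as it would have been there
    slightly earlier, nor strictly on the other side, as it would stay there slightly longer. *)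
Lemma hitting_side s x w : s != 0%R -> X 0%R w = Some x ->
  sigma X (side s x) w < +oo -> X (fine (sigma X (side s x) w)) w = Some x.
Proof.
move=> s0 X0 /hitting_finE[r r0 sr]; rewrite sr /=.
have Xr := hitting_fin_alive sr r0; rewrite Xr; congr Some.
have [//|p|p] := side_total x (position X w r) s0.
  have [e e0 He] := path_cont r0 Xr (open_nbhs_nbhs (conj (@open_side _ _) p)).
  have [r00|r00] := eqVneq r 0%R.
    by exfalso; move: p; rewrite r00 /position X0; exact: side_irr.
  have {}r0 : (0 < r)%R by rewrite lt_neqAle eq_sym r00.
  (* Halving the smaller of [e] and [r] gives a positive time before [r] at which the path is still
     on side [s]. *)
  pose t := (r - Num.min e r / 2)%R.
  have m0 : (0 < Num.min e r)%R by rewrite lt_min e0.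
  have t0 : (0 < t)%R.
    rewrite subr_gt0 ltr_pdivrMr// (le_lt_trans (_ : _ <= r)%R)//.
      by rewrite ge_min lexx orbT.
    by rewrite ltr_pMr// ltr1n.
  have : sigma X (side s x) w <= t%:E.
    apply: ereal_inf_lbound; exists t => //; split=> //; apply: He; first exact: ltW.
    rewrite /t addrAC subrr add0r normrN ger0_norm; last by rewrite divr_ge0// ltW.
    rewrite ltr_pdivrMr// (le_lt_trans (_ : _ <= e)%R)//.
      by rewrite ge_min lexx.
    by rewrite ltr_pMr// ltr1n.
  by rewrite sr lee_fin leNgt ltrBlDr ltrDl divr_gt0.
have [e e0 He] := path_cont r0 Xr (open_nbhs_nbhs (conj (@open_side _ _) p)).
have [t [t0 rt te [b xb Xt]]] := hitting_witness sr e0.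
have [] := He t (ltW t0); first by rewrite ger0_norm ?subr_ge0// ltrBlDl.
by move=> z zx; rewrite -Xt => -[zb]; subst z; case: (side_asym xb zx).
Qed.

Lemma start_filt x t : (0 <= t)%R -> filt X t [set w | X 0%R w = Some x].
Proof.
move=> t0; apply: (@filt_mono _ _ _ X 0%R t) => //.
have -> : [set w | X 0%R w = Some x] = X 0%R @^-1` (Some @` [set x]).
  by apply/seteqP; split=> w /=; [move=> ->; exists x|move=> [_ ->]].
by apply: proc_adapted => //; exact: measurable_Some.
Qed.

Lemma measurable_start x : measurable [set w | X 0%R w = Some x].
Proof. by apply: (filt_measurable (lexx 0%R)); exact: start_filt. Qed.

(** Under [Prob X x] almost every path starts at [x], so events need comparing only on such paths.
    This is how all pathwise arguments below become inequalities of probabilities. *)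
Lemma Prob_start_le x A L : measurable A -> measurable L ->
  (forall w, X 0%R w = Some x -> A w -> L w) -> Prob X x A <= Prob X x L.
Proof.
move=> mA mL AL; have mx := measurable_start x.
have mCx := measurableC mx.
have P0 : Prob X x (~` [set w | X 0%R w = Some x]) = 0.
  rewrite probability_setC// [X in 1 - X](_ : _ = 1) ?subee//.
  exact: (law_start X (Some x)).
apply: (@le_trans _ _ (Prob X x (L `|` ~` [set w | X 0%R w = Some x]))).
  apply: le_measure; rewrite ?inE//; first exact: measurableU.
  move=> w Aw; have [/AL/(_ Aw)|] := pselect (X 0%R w = Some x); first by left.
  by right.
by apply: (le_trans (measureU2 _ _ _)) => //; rewrite [X in _ + X]P0 adde0.
Qed.

Lemma Prob_start_eq x A L : measurable A -> measurable L ->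
  (forall w, X 0%R w = Some x -> A w <-> L w) -> Prob X x A = Prob X x L.
Proof.
move=> mA mL AL; apply/eqP; rewrite eq_le !Prob_start_le//.
  by move=> w /AL[].
by move=> w /AL[].
Qed.

Lemma filtI t A L : (0 <= t)%R -> filt X t A -> filt X t L ->
  filt X t (A `&` L).
Proof. by move=> t0; rewrite (sigma_algebraE (filt_sigma X t0)); exact: measurableI. Qed.

(* The event of [strong_markov] is not known to be measurable; E is any measurable
   event that agrees with it on the paths started at x. *)
Lemma smarkov_at x z T L A (E : set Omega) : stopping_time (filt X) T ->
  stopped_sigma (filt X) T L -> natural_sigma X A -> measurable E ->
  (forall w, X 0%R w = Some x -> T w < +oo -> X (fine (T w)) w = Some z) ->
  (forall w, X 0%R w = Some x ->
    E w <-> [/\ L w, T w < +oo & A (Defs.shift X (fine (T w)) w)]) ->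
  Prob X x E = Prob X z A * Prob X x (L `&` [set w | T w < +oo]).
Proof.
move=> sT [mL sL] nA mE XT ELA.
pose L0 := L `&` [set w | X 0%R w = Some x].
have mx := measurable_start x.
have mT := stopping_fin_measurable sT.
have sL0 : stopped_sigma (filt X) T L0.
  split; first exact: measurableI.
  by move=> t t0; rewrite /L0 setIAC; apply: filtI => //; [exact: sL|exact: start_filt].
have ExE : E `&` [set w | X 0%R w = Some x] =
    [set w | [/\ L0 w, T w < +oo & A (Defs.shift X (fine (T w)) w)]].
  by apply/seteqP; split=> w [] => [/ELA + X0|[Lw X0] Tw Aw];
    [move=> /(_ X0)[]|split=> //; exact/ELA].
transitivity (Prob X x (E `&` [set w | X 0%R w = Some x])).
  apply: Prob_start_eq => //; first exact: measurableI.
  by move=> w X0; split=> [|[]].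
rewrite ExE; have := strong_markov (Some x) sT sL0 nA; rewrite -/(Prob X x) => ->.
rewrite (eq_integral (cst (Prob X z A))); last first.
  move=> w; rewrite inE => -[[Lw X0] Tw] /=.
  by rewrite (XT w X0 Tw).
rewrite integral_cst//; last by apply: measurableI => //; exact: measurableI.
congr (_ * _); apply: Prob_start_eq.
- by apply: measurableI => //; exact: measurableI.
- exact: measurableI.
- by move=> w X0; split=> [[[]]|[]].
Qed.

Lemma stopped_setT T : stopping_time (filt X) T -> stopped_sigma (filt X) T setT.
Proof.
by move=> sT; split=> // t t0; rewrite setTI; exact: sT.2.
Qed.

Lemma cst_stopping t : (0 <= t)%R -> stopping_time (filt X) (fun=> t%:E).
Proof.
move=> t0; split=> [w|u u0]; first by rewrite lee_fin.
rewrite (sigma_algebraE (filt_sigma X u0)).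
have [tu|tu] := leP t u.
  by rewrite [Y in measurable Y](_ : _ = setT)//; apply/seteqP; split=> w //= _.
rewrite [Y in measurable Y](_ : _ = set0)//; apply/seteqP; split=> w //=.
by rewrite lee_fin leNgt tu.
Qed.

Lemma hitting_eq0_shift B w :
  sigma X B (Defs.shift X 0%R w) = 0 <-> sigma X B w = 0.
Proof.
split=> /hitting_eq0P H; apply/hitting_eq0P => e /H.
  by move=> /hits_shift; rewrite addr0 add0e; exact.
by move=> h; apply/hits_shift => //; rewrite addr0 add0e.
Qed.

Lemma mulee01 (p : \bar R) : p \is a fin_num -> p = p * p -> p = 0 \/ p = 1.
Proof.
case: p => // r _; rewrite -EFinM => -[] /eqP.
rewrite -subr_eq0 -{1}(mulr1 r) -mulrBr mulf_eq0 => /orP[/eqP ->|]; first by left.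
by rewrite subr_eq0 => /eqP <-; right.
Qed.

(* Blumenthal: the Markov property at time 0 gives p = p ^ 2. *)
Lemma zero_one x B : open_or_point B ->
  Prob X x [set w | sigma X B w = 0] = 0 \/ Prob X x [set w | sigma X B w = 0] = 1.
Proof.
move=> gB; set A := [set w | _]; have mA : measurable A := measurable_hitting_eq0 X gB.
apply: mulee01; first exact: fin_num_measure.
have fA : filt X 0 A by exact: filt_hitting_eq0.
have sA : stopped_sigma (filt X) (cst 0) A.
  split=> // t t0; apply: filtI => //; last exact: (cst_stopping (lexx _)).2.
  exact: (@filt_mono _ _ _ X 0%R t).
rewrite {1}(@smarkov_at x x (cst 0) A A) => //.
- congr (_ * Prob X x _); apply/seteqP; split=> w; first by case.
  by move=> Aw; split=> //; exact: ltry.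
- exact: cst_stopping.
- exact: natural_hitting_eq0.
- move=> w _; split=> [Aw|[//]].
  by split=> //=; exact/hitting_eq0_shift.
Qed.

(** At the first entrance into the side the path is at [x], and it enters the side immediately
    afterwards. By the strong Markov property the probability of ever entering therefore has the
    factor P_x(immediate entrance) = 0. *)
Lemma no_return s x : s != 0%R ->
  Prob X x [set w | sigma X (side s x) w = 0] = 0 ->
  Prob X x (hits X (side s x) 0 +oo) = 0.
Proof.
move=> s0 p0; set T := sigma X (side s x).
have sT : stopping_time (filt X) T by exact: hitting_stopping.
have hT : hits X (side s x) 0 +oo = [set w | T w < +oo].
  by apply/seteqP; split=> w /hitting_ltP.
rewrite hT (@smarkov_at x x T setT [set w | T w = 0]) => //.
- by rewrite p0 mul0e.
- exact: stopped_setT.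
- exact: natural_hitting_eq0.
- exact: stopping_fin_measurable sT.
- by move=> w X0 Tw; exact: hitting_side.
(* The visits soon after [T] come strictly after it, because at [T] the path is at [x], which is not
   on the side. *)
move=> w X0; split=> [Tw|[]//]; split=> //; apply/hitting_eq0P => e e0.
have XT := hitting_side s0 X0 Tw.
have [r r0 Tr] := hitting_finE Tw; rewrite /T Tr /= in XT *.
apply/hits_shift => //; rewrite addr0.
have [t [t0 rt te Bt]] := hitting_witness Tr e0.
exists t; split => //; rewrite lt_neqAle rt andbT; apply/eqP => rt'.
by case: Bt => b; rewrite -rt' XT => /[swap] -[->] /side_irr.
Qed.

Lemma hits_fin B w : hits X B 0 +oo w <-> sigma X B w < +oo.
Proof. by rewrite hitting_ltP. Qed.

Lemma reachesE x y : reaches X x y <-> 0 < Prob X x (hits X [set y] 0 +oo).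
Proof.
rewrite /reaches [Y in Prob X x Y](_ : _ = hits X [set y] 0 +oo)//.
by apply/seteqP; split=> w /hits_fin.
Qed.

Lemma start_path w x t y : X 0%R w = Some x -> (0 < t)%R -> X t w = Some y ->
  forall z, btw x z y -> exists2 r, (0 < r < t)%R & X r w = Some z.
Proof.
move=> X0 t0 Xt z xzy.
by have [r [r0 rt Xr]] := path_IVT (lexx _) t0 X0 Xt xzy; exists r => //; rewrite r0.
Qed.

Lemma hits_point_after y B w r : sigma X [set y] w < +oo -> X r w = Some y ->
  (0 < r)%R -> hits X B r +oo w -> hits_after X (sigma X [set y]) B +oo w.
Proof.
move=> Ty Xr r0 [t [rt _ Bt]]; split=> //.
have [T T0 TE] := hitting_finE Ty.
have Tr : (T <= r)%R.
  by rewrite -lee_fin -TE; apply: ereal_inf_lbound; exists r => //; split=> //; exists y.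
by rewrite TE /=; apply/hits_shift => //; exists t; rewrite addr0 (le_lt_trans Tr)// ltry.
Qed.

(** Strong Markov property at the hitting time of [y], where the path is at [y]. The bound [v'] on
    that time is kept so that two short delays can be added later. *)
Lemma Prob_hits_after x y B v' v : open_or_point B ->
  Prob X x (hits X [set y] 0 v' `&` hits_after X (sigma X [set y]) B v) =
  Prob X y (hits X B 0 v) * Prob X x (hits X [set y] 0 v').
Proof.
move=> gB; have sT := hitting_stopping X (good_point y).
have mv : measurable (hits X [set y] 0 v') by exact: measurable_hits.
rewrite (@smarkov_at x y (sigma X [set y]) (hits X [set y] 0 v') (hits X B 0 v))//.
- congr (_ * Prob X x _); apply/seteqP; split=> w; first by case.
  by move=> yw; split=> //; apply/hits_fin; apply: hitsS yw => //; exact: leey.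
- split=> // t t0.
  (* Being hit before [v'] and being hit by time [t] are nested events, so their intersection is the
     more restrictive one. *)
  rewrite [Y in filt X t Y](_ : _ = if v' <= t%:E then hits X [set y] 0 v'
     else [set w | sigma X [set y] w <= t%:E]).
    case: ifPn => [vt|_]; last exact: sT.2.
    exact: filt_hits.
  case: ifPn => [vt|tv]; apply/seteqP; split=> w.
  - by case.
  - move=> yw; split=> //=; apply: ltW; apply: (lt_le_trans _ vt).
    exact/hitting_ltP.
  - by case.
  - rewrite -ltNge in tv; move=> /= st; split=> //; apply/hitting_ltP.
    exact: le_lt_trans st _.
- exact: natural_hits.
- by apply: measurableI => //; exact: measurable_hits_after.
- by move=> w _; exact: hitting_point.
- by move=> w _; split=> [[? []]|[]].
Qed.

Lemma Prob_hits_after_infty x y B : open_or_point B ->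
  Prob X x (hits_after X (sigma X [set y]) B +oo) =
  Prob X y (hits X B 0 +oo) * Prob X x (hits X [set y] 0 +oo).
Proof.
move=> gB; rewrite -Prob_hits_after//; congr (Prob X x _).
by apply/seteqP; split=> w [] // sy ?; split=> //; exact/hits_fin.
Qed.

(** A continuous path from [x] to [y] passes through [z], and the strong Markov property at its
    first passage there factors the probability; a positive product has two positive factors. *)
Lemma reaches_through x y z : btw x z y -> reaches X x y ->
  reaches X x z /\ reaches X z y.
Proof.
move=> xzy /reachesE xy.
have : 0 < Prob X x (hits_after X (sigma X [set z]) [set y] +oo).
  apply: (lt_le_trans xy); apply: Prob_start_le; first exact: measurable_hits.
    by apply: measurable_hits_after => //; exact: hitting_stopping.
  move=> w X0 [t [t0 ty [_ -> Xt]]].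
  have [r /andP[r0 rt] Xr] := start_path X0 t0 (esym Xt) xzy.
  apply: (@hits_point_after _ _ _ r) => //; last by exists t; split=> //; exists y.
  by apply/hits_fin; exists r; split=> //; [exact: ltry|exists z].
rewrite Prob_hits_after_infty// mule_ge0_gt0// => /andP[zy xz].
by split; exact/reachesE.
Qed.

Lemma reaches_trans x y z : reaches X x y -> reaches X y z -> reaches X x z.
Proof.
move=> /reachesE xy /reachesE yz; apply/reachesE.
apply: (lt_le_trans (mule_gt0 yz xy)); rewrite -Prob_hits_after_infty//.
apply: le_measure; rewrite ?inE.
- by apply: measurable_hits_after => //; exact: hitting_stopping.
- exact: measurable_hits.
- move=> w [/hitting_finE[r r0 ->] /=] /hits_shift-/(_ r0 (lexx _)).
  by apply: hitsS => //; rewrite ?addr0// leey.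
Qed.

(** The Markov property at the fixed time [q] writes the probability as an integral of P_y(A) over
    positions y in [B], which cannot be positive if the integrand vanishes throughout. *)
Lemma markov_exists x q B A : (0 <= q)%R -> measurable B -> natural_sigma X A ->
  0 < Prob X x [set w | (Some @` B) (X q w) /\ A (Defs.shift X q w)] ->
  exists2 y, B y & 0 < Prob X y A.
Proof.
move=> q0 mB nA H; apply: contrapT => nex; move: H; apply/negP.
rewrite -leNgt; have sq := cst_stopping q0.
pose L := X q @^-1` (Some @` B).
have mSB := measurable_Some mB.
have sL : stopped_sigma (filt X) (fun=> q%:E) L.
  split; first by apply: (filt_measurable q0); exact: proc_adapted.
  move=> t t0; have [qt|tq] := leP q t.
    apply: filtI => //; last exact: sq.2.
    by apply: (@filt_mono _ _ _ X q t) => //; exact: proc_adapted.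
  rewrite [Y in filt X t Y](_ : _ = set0); first by case: (filt_sigma X t0).
  by apply/seteqP; split=> w // [_] /=; rewrite lee_fin leNgt tq.
have := strong_markov (Some x) sq sL nA; rewrite -/(Prob X x) /=.
rewrite [Y in Prob X x Y = _](_ : _ =
    [set w | (Some @` B) (X q w) /\ A (Defs.shift X q w)]); last first.
  by apply/seteqP; split=> w /=; [case=> ? _ ?|case=> ? ?; split=> //; exact: ltry].
move=> ->; rewrite (eq_integral (cst 0)) ?integral0//.
move=> w; rewrite inE => -[[b Bb <-] _] /=; apply/eqP; rewrite eq_le measure_ge0 andbT.
by rewrite leNgt; apply/negP => b0; apply: nex; exists b.
Qed.

End Markov.

#[local] Hint Resolve good_side good_point : core.

(** * Immediate return to a point that can be reached from the side it enters *)

Section SelfRegular.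
Context {R : realType} {d : measure_display} {Omega : measurableType d}.
Variable X : diffusion R Omega.
Implicit Types (B U : set R) (r s t u x y z : R) (v : \bar R) (w : Omega).
Implicit Types (A E H : set Omega).

Definition e_side s x : \bar R := Prob X x [set w | sigma X (side s x) w = 0].

Definition self_regular x : Prop := Prob X x [set w | sigma X [set x] w = 0] = 1.

Lemma Prob_as_le x A E H : measurable A -> measurable E -> measurable H ->
  Prob X x A = 1 -> (forall w, X 0%R w = Some x -> A w -> H w -> E w) ->
  Prob X x H <= Prob X x E.
Proof.
move=> mA mE mH A1 AHE; have mCA := measurableC mA.
apply: (@le_trans _ _ (Prob X x (E `|` ~` A))).
  apply: Prob_start_le => //; first exact: measurableU.
  move=> w X0 Hw; have [Aw|] := pselect (A w); last by right.
  by left; exact: AHE.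
apply: (le_trans (measureU2 _ _ _)) => //.
have A0 : Prob X x (~` A) = 0 by rewrite probability_setC// [X in 1 - X]A1 subee.
by rewrite [Y in _ + Y]A0 adde0.
Qed.

Lemma Prob_rat0 x (E : rat -> set Omega) : (forall q, measurable (E q)) ->
  (forall q, Prob X x (E q) = 0) -> Prob X x (\bigcup_q E q) = 0.
Proof.
move=> mE E0; apply: measure_negligible; first exact: bigcupT_measurable_rat.
have -> : \bigcup_q E q = \bigcup_n (oapp E set0 (unpickle n)).
  apply/seteqP; split=> w [q _].
    by move=> Eq; exists (pickle q); [exact: I|rewrite pickleK; exact: Eq].
  by case: (unpickle q) => //= p Ep; exists p.
apply: negligible_bigcup => n; case: (unpickle n) => [q|] /=.
  by apply/negligibleP; [exact: mE|exact: E0].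
exact: negligible_set0.
Qed.

(** Continuity from below along the increasing events that all [E n] with n >= m occur: their union
    contains [H] up to a null event. *)
Lemma eventually_prob x (E : (set Omega)^nat) H (c : R) :
  (forall n, measurable (E n)) -> measurable H -> c%:E < Prob X x H ->
  (forall w, X 0%R w = Some x -> H w ->
     exists m, forall n, (m <= n)%N -> E n w) ->
  exists m, forall n, (m <= n)%N -> c%:E <= Prob X x (E n).
Proof.
move=> mE mH cH HE.
pose F m := \bigcap_(n in [set n | (m <= n)%N]) E n.
have mF m : measurable (F m) by apply: bigcap_measurable => //; exists m => /=.
have FE m n : (m <= n)%N -> Prob X x (F m) <= Prob X x (E n).
  by move=> mn; apply: le_measure; rewrite ?inE// => w; exact.
have : Prob X x \o F @ \oo --> Prob X x (\bigcup_m F m).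
  apply: nondecreasing_cvg_mu => //; first exact: bigcupT_measurable.
  move=> m n mn; apply/subsetPset => w Fw k /= nk; apply: Fw.
  exact: leq_trans nk.
have cF : c%:E < Prob X x (\bigcup_m F m).
  apply: (lt_le_trans cH); apply: Prob_start_le => //.
    exact: bigcupT_measurable.
  by move=> w X0 /(HE w X0)[m Em]; exists m.
have nF : nbhs (Prob X x (\bigcup_m F m)) [set p : \bar R | c%:E < p].
  by apply: open_nbhs_nbhs; split=> //; exact: open_ereal_gt_ereal.
move=> /(_ _ nF)[m _ Hm].
exists m => n mn; apply: le_trans (FE _ _ mn); apply: ltW.
exact: (Hm m (leqnn m)).
Qed.

(** The factor [s] puts the whole sequence on side [s] of [x], while it converges to [x]. *)
Definition approach s x (n : nat) : R := (x + s * n.+1%:R^-1)%R.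

Lemma approach_btw s x z : s != 0%R -> side s x z ->
  exists m, forall n, (m <= n)%N -> btw x (approach s x n) z.
Proof.
move=> s0 xz; have s20 : (0 < s * s)%R by rewrite -expr2 exprn_even_gt0.
have : (0 < (s * z - s * x) / (s * s))%R by rewrite divr_gt0// subr_gt0.
move=> /ltr_add_invr[m]; rewrite add0r ltr_pdivlMr// => mz.
exists m => n mn; apply: (side_btw s0); rewrite /side/= /approach mulrDr.
  by rewrite ltrDl mulrA mulr_gt0.
rewrite -ltrBrDl; apply: le_lt_trans mz.
by rewrite mulrA mulrC ler_pM2r// lef_pV2 ?posrE// ler_nat.
Qed.

Lemma approach_cvg s x (e : R) : (0 < e)%R ->
  exists m, forall n, (m <= n)%N -> (`|approach s x n - x| < e)%R.
Proof.
move=> e0; have : (0 < e / (`|s| + 1))%R by rewrite divr_gt0// ltr_wpDl.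
move=> /ltr_add_invr[m]; rewrite add0r ltr_pdivlMr ?ltr_wpDl// => me.
exists m => n mn; rewrite /approach addrAC subrr add0r normrM; apply: le_lt_trans me.
rewrite mulrC ler_pM//; last by rewrite lerDl.
by rewrite ger0_norm// lef_pV2 ?posrE// ler_nat.
Qed.

(** Almost every path has visited some z on side [s] before time [e], hence all approach points
    between x and z, which are all but finitely many of them. The value 1/2 is just a constant below
    1. *)
Lemma hits_approach s x (e : R) : s != 0%R -> e_side s x = 1 -> (0 < e)%R ->
  exists m, forall n, (m <= n)%N ->
    (2^-1)%:E <= Prob X x (hits X [set approach s x n] 0 e%:E).
Proof.
move=> s0 e1 e0.
apply: (@eventually_prob _ _ [set w | sigma X (side s x) w = 0]).
- by move=> n; exact: measurable_hits.
- exact: measurable_hitting_eq0.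
- by rewrite -/(e_side s x) e1 lte_fin invf_lt1 ?ltr1n.
- move=> w X0 /hitting_eq0P/(_ _ e0)[t [t0 te [z xz Xt]]].
  have [m Hm] := approach_btw s0 xz; exists m => n /Hm xyz.
  have [r /andP[r0 rt] Xr] := start_path X0 t0 (esym Xt) xyz.
  exists r; split=> //; first by apply: lt_trans te; rewrite lte_fin.
  by exists (approach s x n).
Qed.

(* Since the path is continuous, the hitting times of the approach points
   increase to that of x on the event that x is reached. *)
Lemma reaches_approach s x y : s != 0%R -> side s x y -> reaches X y x ->
  exists2 c : R, (0 < c)%R & forall e, (0 < e)%R -> exists m, forall n, (m <= n)%N ->
    c%:E <= Prob X (approach s x n) (hits X [set x] 0 e%:E).
Proof.
move=> s0 xy /reachesE yx.
have pE : Prob X y (hits X [set x] 0 +oo) \is a fin_num.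
  by apply: fin_num_measure; exact: measurable_hits.
have := yx; rewrite -(fineK pE) lte_fin => p0.
exists (fine (Prob X y (hits X [set x] 0 +oo)) / 2)%R; first by rewrite divr_gt0.
move=> e e0.
have sT n := hitting_stopping X (good_point (approach s x n)).
have [||||m Hm] := @eventually_prob y
    (fun n => hits_after X (sigma X [set approach s x n]) [set x] e%:E)
    (hits X [set x] 0 +oo) (fine (Prob X y (hits X [set x] 0 +oo)) / 2)%R.
- by move=> n; apply: measurable_hits_after.
- exact: measurable_hits.
- by rewrite -[ltRHS](fineK pE) lte_fin ltr_pdivrMr// ltr_pMr// ltr1n.
- move=> w X0 /hits_fin xw.
  have XT := hitting_point xw; have [T T0 TE] := hitting_finE xw.
  rewrite TE /= in XT.
  have yNx : y != x by apply/eqP => yx'; move: xy; rewrite yx'; exact: side_irr.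
  have {}T0 : (0 < T)%R.
    rewrite lt_neqAle T0 andbT; apply/eqP => T0'; move: XT yNx.
    by rewrite -T0' X0 => -[->]; rewrite eqxx.
  have beforeT r : (0 < r)%R -> X r w = Some x -> (T <= r)%R.
    move=> r0 Xr; rewrite -lee_fin -TE; apply: ereal_inf_lbound.
    by exists r => //; split=> //; exists x.
  (* Up to time [b], which is before [T], the path keeps a positive distance from [x]. Approach
     points closer to [x] than that are first hit after [b], so [T] follows within less than [e]. *)
  pose b := Num.max 0%R (T - e / 2)%R.
  have b0 : (0 <= b)%R by rewrite le_max lexx.
  have bT : (b < T)%R by rewrite gt_max T0 ltrBlDr ltrDl divr_gt0.
  have aliveb r : (0 <= r <= b)%R -> X r w = Some (position X w r).
    move=> /andP[r0 rb]; apply: path_alive XT.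
    by rewrite r0 (le_trans rb (ltW bT)).
  have cf : {within `[0%R, b]%classic,
      continuous (fun t => `|position X w t - x|%R)}.
    have Xb := aliveb b; rewrite b0 lexx in Xb.
    have /subspace_continuousP cX := path_continuous_itv (lexx 0%R) (Xb isT).
    apply/subspace_continuousP => t tab.
    by apply: cvg_norm; apply: cvgB; [exact: cX|exact: cvg_cst].
  have [c] := EVT_min b0 cf; rewrite in_itv/= => /andP[c0 cb] Hc.
  have mu0 : (0 < `|position X w c - x|)%R.
    rewrite normr_gt0 subr_eq0; apply/eqP => pc.
    have Xc : X c w = Some x by rewrite aliveb ?c0// pc.
    move: c0; rewrite le_eqVlt => /orP[/eqP c0|/beforeT/(_ Xc)].
      by move: Xc yNx; rewrite -c0 X0 => -[->]; rewrite eqxx.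
    by rewrite leNgt (le_lt_trans cb).
  have [m1 Hm1] := approach_btw s0 xy; have [m2 Hm2] := approach_cvg s x mu0.
  exists (maxn m1 m2) => n; rewrite geq_max => /andP[/Hm1 xny /Hm2 nmu].
  set yn := approach s x n in xny nmu *.
  have [|r /andP[r0 rT] Xr] := start_path X0 T0 XT (_ : btw y yn x).
    by case: xny => xny; [right|left].
  have yw : sigma X [set yn] w < +oo.
    by apply/hits_fin; exists r; rewrite ltry; split=> //; exists yn.
  have Xyn := hitting_point yw; have [u u0 uE] := hitting_finE yw.
  rewrite uE /= in Xyn; split=> //; rewrite uE /=.
  have ur : (u <= r)%R.
    by rewrite -lee_fin -uE; apply: ereal_inf_lbound; exists r => //; split=> //; exists yn.
  have bu : (b < u)%R.
    rewrite ltNge; apply/negP => ub.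
    have := Hc u; rewrite in_itv/= u0 ub => /(_ isT).
    by rewrite /position Xyn /= leNgt -/yn nmu.
  apply/hits_shift => //; exists T; rewrite addr0; split.
  - exact: le_lt_trans ur rT.
  - rewrite -EFinD lte_fin -ltrBlDr.
    apply: le_lt_trans bu; rewrite le_max; apply/orP; right.
    by rewrite lerD2l lerN2 ler_pdivrMr// ler_pMr// ler1n.
  - by exists x.
exists m => n /Hm /le_trans; apply.
have := @Prob_hits_after _ _ _ X y (approach s x n) [set x] +oo e%:E (good_point x).
rewrite [Y in Prob X y Y = _](_ : _ =
    hits_after X (sigma X [set approach s x n]) [set x] e%:E).
  move=> ->; rewrite -[leRHS]mule1 lee_wpmul2l ?measure_ge0//.
  by apply: probability_le1; exact: measurable_hits.
by apply/seteqP; split=> w [] // ? ?; split=> //; exact/hits_fin.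
Qed.

(** Within time e/2 the path goes from [x] to a nearby approach point with probability at least 1/2,
    and from there back to [x] within e/2 with probability at least c. So a return before [e] has
    probability at least c/2 for all [e], which forces P_x(sigma_x = 0) > 0, hence 1 by the 0-1
    law. *)
Lemma self_regular_entrance s x y : s != 0%R -> e_side s x = 1 ->
  side s x y -> reaches X y x -> self_regular x.
Proof.
move=> s0 e1 xy yx.
have [p0|//] := zero_one X x (good_point x); exfalso.
have [c c0 Hc] := reaches_approach s0 xy yx.
have mx (e : R) : measurable (hits X [set x] 0 e%:E) by exact: measurable_hits.
have lower (e : R) : (0 < e)%R -> (c / 2)%:E <= Prob X x (hits X [set x] 0 e%:E).
  move=> e0; have e20 : (0 < e / 2)%R by rewrite divr_gt0.
  have [m1 Hm1] := Hc _ e20; have [m2 Hm2] := hits_approach s0 e1 e20.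
  set n := maxn m1 m2; set yn := approach s x n.
  have : c%:E * (2^-1)%:E <= Prob X yn (hits X [set x] 0 (e / 2)%:E) *
      Prob X x (hits X [set yn] 0 (e / 2)%:E).
    apply: lee_pmul; rewrite ?lee_fin ?invr_ge0 ?(ltW c0)//.
      by apply: Hm1; exact: leq_maxl.
    by apply: Hm2; exact: leq_maxr.
  rewrite -Prob_hits_after// => /le_trans; apply.
  apply: le_measure; rewrite ?inE//.
    apply: measurableI; first exact: measurable_hits.
    by apply: measurable_hits_after => //; exact: hitting_stopping.
  move=> w [/hitting_ltP + [/hitting_finE[r r0 rE]]]; rewrite rE lte_fin /= => re.
  move=> /hits_shift-/(_ r0 (lexx _)); apply: hitsS => //; first by rewrite addr0.
  by rewrite -EFinD lee_fin [leRHS]splitr lerD2r ltW.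
(* If immediate return had probability 0, a return before 1/(m+1) would have probability at most c/4
   for some m, against the lower bound c/2. *)
have [||||m /(_ m (leqnn m))] := @eventually_prob x
  (fun n => ~` hits X [set x] 0 n.+1%:R^-1%:E)
  (~` [set w | sigma X [set x] w = 0]) (1 - c / 4)%R.
- by move=> n; exact: measurableC.
- by apply: measurableC; exact: measurable_hitting_eq0.
- rewrite probability_setC; last exact: measurable_hitting_eq0.
  by rewrite [X in 1 - X]p0 sube0 lte_fin ltrBlDr ltrDl divr_gt0.
- move=> w _ /= Nw; apply: contrapT => Hm; apply: Nw; apply/hitting_eq0P => e e0.
  have /ltr_add_invr[m] := e0; rewrite add0r => me.
  apply: contrapT => Ne; apply: Hm; exists m => n mn xn; apply: Ne.
  apply: hitsS xn => //; rewrite lee_fin (le_trans _ (ltW me))//.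
  by rewrite lef_pV2 ?posrE// ler_nat.
rewrite probability_setC//.
have /fineK <- : Prob X x (hits X [set x] 0 m.+1%:R^-1%:E) \is a fin_num.
  exact: fin_num_measure.
rewrite -EFinD lee_fin lerD2l lerN2 => hle.
have := lower m.+1%:R^-1%R; rewrite invr_gt0 ltr0n => /(_ isT).
have /fineK <- : Prob X x (hits X [set x] 0 m.+1%:R^-1%:E) \is a fin_num.
  exact: fin_num_measure.
rewrite lee_fin => /le_trans/(_ hle); rewrite ler_pM2l//.
by rewrite leNgt ltf_pV2 ?posrE// ltr_nat.
Qed.

End SelfRegular.

(** * Regular points, shunts and traps in terms of reachability *)

Section PointTypes.
Context {R : realType} {d : measure_display} {Omega : measurableType d}.
Variable X : diffusion R Omega.
Implicit Types (B : set R) (s t u v x y z : R) (w : Omega).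

Lemma e_side01 s x : e_side X s x = 0 \/ e_side X s x = 1.
Proof. by apply: zero_one. Qed.

Lemma reaches_e_side s x y : s != 0%R -> side s x y -> reaches X x y ->
  e_side X s x = 1.
Proof.
move=> s0 xy /reachesE xry; have [/(no_return s0) p0|//] := e_side01 s x.
move: xry; apply: contraPeq => _; apply/negP; rewrite -leNgt -[leRHS]p0.
apply: le_measure; rewrite ?inE; do ?exact: measurable_hits.
by apply: hitsS => // _ ->.
Qed.

Lemma self_regular_reaches x : self_regular X x -> reaches X x x.
Proof.
move=> x1; apply/reachesE; apply: (@lt_le_trans _ _ 1) => //.
rewrite -x1; apply: le_measure; rewrite ?inE.
- exact: measurable_hitting_eq0.
- exact: measurable_hits.
- by move=> w /= xw; apply/hits_fin; rewrite xw ltry.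
Qed.

Lemma reaches_beyond s x : s != 0%R -> e_side X s x = 1 ->
  exists2 y, side s x y & reaches X x y.
Proof.
move=> s0 e1; have [m /(_ m (leqnn m)) Hm] := hits_approach s0 e1 ltr01.
exists (approach s x m).
  rewrite /side/= /approach mulrDr ltrDl mulrA mulr_gt0//.
  by rewrite -expr2 exprn_even_gt0.
apply/reachesE; apply: (@lt_le_trans _ _ (2^-1)%:E); first by rewrite lte_fin.
apply: (le_trans Hm); apply: le_measure; rewrite ?inE; do ?exact: measurable_hits.
by apply: hitsS => //; exact: leey.
Qed.

(** Before any return to [x] the path has already been on side [s], and, that side being open, at a
    rational time. The Markov property at this time yields a point of the side from which [x] is
    reached. *)
Lemma returns_from_side s x : e_side X s x = 1 -> reaches X x x ->
  exists2 y, side s x y & reaches X y x.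
Proof.
move=> e1 /reachesE xx; apply: contrapT => nex; move: xx; apply/negP.
rewrite -leNgt.
pose E (q : rat) : set Omega := if (0 <= ratr q :> R)%R
  then [set w | (Some @` side s x) (X (ratr q) w) /\
                hits X [set x] 0 +oo (Defs.shift X (ratr q) w)] else set0.
have mE q : measurable (E q).
  rewrite /E; case: ifPn => // q0.
  rewrite [Y in measurable Y](_ : _ = X (ratr q) @^-1` (Some @` side s x) `&`
      hits X [set x] (ratr q) +oo).
    apply: measurableI; last exact: measurable_hits.
    apply: (filt_measurable q0); apply: proc_adapted => //.
    by apply: measurable_Some; apply: open_measurable; exact: open_side.
  apply/seteqP; split=> w [sw xw]; split=> //.
    by move: xw => /(hits_shift _ _ _ _ q0 (lexx _)); rewrite addr0.
  by apply/hits_shift => //; rewrite addr0.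
have E0 q : Prob X x (E q) = 0.
  rewrite /E; case: ifPn => [q0|_]; last exact: measure0.
  apply/eqP; rewrite eq_le measure_ge0 andbT leNgt; apply/negP => Eq.
  have [||y xy yx] := markov_exists q0 _ _ Eq.
  - by apply: open_measurable; exact: open_side.
  - exact: natural_hits.
  - by apply: nex; exists y => //; exact/reachesE.
rewrite -(Prob_rat0 mE E0).
apply: (Prob_as_le (A := [set w | sigma X (side s x) w = 0])) => //.
- exact: measurable_hitting_eq0.
- exact: bigcupT_measurable_rat.
- exact: measurable_hits.
move=> w X0 /hitting_eq0P sw [t [t0 ty xt]].
have [r [r0 rt [z xz Xr]]] := sw t t0.
have [e e0 He] := path_cont (ltW r0) (esym Xr) (open_nbhs_nbhs (conj (@open_side _ s x) xz)).
rewrite lte_fin in rt.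
have /rat_in_itvoo[q] : (r < Num.min t (r + e))%R by rewrite lt_min rt ltrDl.
rewrite in_itv/= lt_min => /and3P[rq qt qe].
have q0 : (0 <= ratr q :> R)%R by rewrite (le_trans (ltW r0))// ltW.
exists q => //; rewrite /E q0; split.
  by apply: He => //; rewrite ger0_norm ?subr_ge0 ?(ltW rq)// ltrBlDl.
by apply/hits_shift => //; exists t; rewrite addr0.
Qed.

Lemma side_gt0 s x : (0 < s)%R -> side s x = [set y | (x < y)%R].
Proof. by move=> s0; apply/seteqP; split=> y; rewrite /side/= ltr_pM2l. Qed.

Lemma side_lt0 s x : (s < 0)%R -> side s x = [set y | (y < x)%R].
Proof. by move=> s0; apply/seteqP; split=> y; rewrite /side/= ltr_nM2l. Qed.

Lemma e_plusE x : e_plus X x = e_side X 1 x.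
Proof. by rewrite /e_side side_gt0. Qed.

Lemma e_minusE x : e_minus X x = e_side X (-1) x.
Proof. by rewrite /e_side side_lt0// ltrN10. Qed.

Lemma e_side_sg s x : s != 0%R ->
  e_side X s x = if (0 < s)%R then e_plus X x else e_minus X x.
Proof.
rewrite neq_lt /e_side => /orP[s0|s0].
  by rewrite ltNge (ltW s0)/= side_lt0.
by rewrite s0 side_gt0.
Qed.

Lemma Lambda2E s x : s != 0%R ->
  Lambda2 X x <-> e_side X s x = 1 /\ e_side X (- s) x = 1.
Proof.
move=> s0; rewrite !e_side_sg ?oppr_eq0// oppr_gt0 /Lambda2/=.
by have [s1|s1|s1] := ltgtP s 0%R; [split=> -[]| |rewrite s1 eqxx in s0].
Qed.

(** Side [s] contains a point [y1] from which [x] is reached and a point [y2] reached from [x]; take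
    for [y] the one closer to [x]. Any [u] before it is crossed in both directions, so paths from
    [u] leave to both sides and [u] is regular. *)
Lemma two_way s x : s != 0%R -> e_side X s x = 1 -> reaches X x x ->
  exists2 y, side s x y & forall u, btw x u y ->
    [/\ reaches X x u, reaches X u x & Lambda2 X u].
Proof.
move=> s0 e1 xx.
have [y1 xy1 y1x] := returns_from_side e1 xx.
have [y2 xy2 xy2r] := reaches_beyond s0 e1.
have [y [xy H]] : exists y, side s x y /\
    forall u, side s u y -> side s u y1 /\ side s u y2.
  have [y12|y21] := leP (s * y1)%R (s * y2)%R.
    exists y1; split=> // u uy1; split=> //.
    by rewrite /side/= (lt_le_trans uy1).
  exists y2; split=> // u uy2; split=> //.
  by rewrite /side/= (lt_trans uy2).
exists y => // u xuy.
have [xu uy] := btw_side s0 xy xuy.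
have [uy1 uy2] := H _ uy.
have [xru ury2] := reaches_through (side_btw s0 xu uy2) xy2r.
have Ns0 : (- s != 0)%R by rewrite oppr_eq0.
have [y1u ux] : reaches X y1 u /\ reaches X u x.
  by apply: reaches_through => //; apply: (side_btw Ns0); apply/sideN.
split=> //; apply/(Lambda2E _ s0); split.
  exact: reaches_e_side ury2.
by apply: reaches_e_side ux => //; apply/sideN.
Qed.

(** In arbitrarily short time the path visits both sides of [x], so it crosses [x] in between. *)
Lemma Lambda2_self_regular x : Lambda2 X x -> self_regular X x.
Proof.
move=> [ep em].
have [mx mp mm] : [/\ measurable [set w | sigma X [set x] w = 0],
    measurable [set w | sigma X [set y | (x < y)%R] w = 0] &
    measurable [set w | sigma X [set y | (y < x)%R] w = 0]].
  split; apply: measurable_hitting_eq0 => //.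
    by left; exact: open_gt.
  by left; exact: open_lt.
apply/eqP; rewrite eq_le probability_le1//= -em.
apply: (Prob_as_le mp mx mm ep) => w X0 /hitting_eq0P pw /hitting_eq0P mw.
apply/hitting_eq0P => e e0.
have [t [t0 te [y xy Xt]]] := pw e e0.
have [r [r0 rt [z zx Xr]]] := mw t t0.
rewrite lte_fin in rt.
have [u [ru ut Xu]] := path_IVT (ltW r0) rt (esym Xr) (esym Xt)
  (or_introl (introT andP (conj zx xy))).
exists u; split; first exact: lt_trans ru.
  by apply: lt_trans te; rewrite lte_fin.
by exists x.
Qed.

(** Neither side is ever entered, so the path sits at [x] as long as it lives, and it lives for a
    positive time. *)
Lemma trap_self_regular s x : s != 0%R -> e_side X s x = 0 -> e_side X (- s) x = 0 ->
  self_regular X x.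
Proof.
move=> s0 /(no_return s0) p; have Ns0 : (- s != 0)%R by rewrite oppr_eq0.
move=> /(no_return Ns0) m.
have ms t : measurable (hits X (side t x) 0 +oo) by exact: measurable_hits.
have N1 t : Prob X x (hits X (side t x) 0 +oo) = 0 ->
    Prob X x (~` hits X (side t x) 0 +oo) = 1.
  by move=> h; rewrite probability_setC// [Y in 1 - Y]h sube0.
have mx := measurable_hitting_eq0 X (good_point x).
apply/eqP; rewrite eq_le probability_le1//= -(N1 _ p).
apply: (Prob_as_le _ _ _ (N1 _ m)) => //; try exact: measurableC.
move=> w X0 Nm Np; apply/hitting_eq0P => e e0.
have [e' e'0 He'] := path_cont (lexx 0%R) X0 filterT.
have m0 : (0 < Num.min e e')%R by rewrite lt_min e0.
pose t := (Num.min e e' / 2)%R.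
have t0 : (0 < t)%R by rewrite divr_gt0.
have tm : (t < Num.min e e')%R by rewrite ltr_pdivrMr// ltr_pMr// ltr1n.
move: tm; rewrite lt_min => /andP[te te'].
have [|y _ Xt] := He' t (ltW t0); first by rewrite subr0 gtr0_norm.
exists t; split=> //; exists y => //=.
have [//|h|h] := side_total x y s0; exfalso.
  by apply: Np; exists t; split=> //; [exact: ltry|exists y].
by apply: Nm; exists t; split=> //; [exact: ltry|exists y].
Qed.

End PointTypes.

(** * Components of the regular set, and thin points *)

Section Components.
Context {R : realType} {d : measure_display} {Omega : measurableType d}.
Variable X : diffusion R Omega.
Implicit Types (B : set R) (s t u v x y z : R) (w : Omega).

(** Besides openness of [Lambda2], this gives the two-way reachability of nearby points that drives
    the connectedness argument. *)
Lemma Lambda2_near x : Lambda2 X x ->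
  \forall u \near x, [/\ Lambda2 X u, reaches X x u & reaches X u x].
Proof.
move=> L2x; have xx := self_regular_reaches (Lambda2_self_regular L2x).
have n1 : (1 != 0 :> R)%R by exact: oner_neq0.
have Nn1 : (-1 != 0 :> R)%R by rewrite oppr_eq0.
have [ep em] := (Lambda2E X x n1).1 L2x.
have [y2 xy2 H2] := two_way n1 ep xx; have [y1 y1x H1] := two_way Nn1 em xx.
rewrite side_gt0//= in xy2; rewrite side_lt0 ?ltrN10//= in y1x.
have : x \in `]y1, y2[ by rewrite in_itv/= y1x.
move=> /near_in_itvoo; apply: filterS => u; rewrite in_itv/= => /andP[y1u uy2].
have [ux|xu|->//] := ltgtP u x.
  by have [|? ? ?] := H1 u; [right; rewrite y1u|split].
by have [|? ? ?] := H2 u; [left; rewrite xu|split].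
Qed.

Lemma is_interval_btw x y : is_interval [set u | btw x u y].
Proof.
move=> u v xuy xvy z /andP[uz zv]; case: xuy xvy => /andP[h1 h2] [] /andP[h3 h4].
- by left; rewrite (lt_le_trans h1)// (le_lt_trans zv).
- by have := lt_trans h1 (lt_trans h2 (lt_trans h3 h4)); rewrite ltxx.
- by have := lt_trans h1 (lt_trans h2 (lt_trans h3 h4)); rewrite ltxx.
- by right; rewrite (lt_le_trans h1)// (le_lt_trans zv).
Qed.

Lemma btw_open x y u : btw x u y -> \forall z \near u, btw x z y.
Proof.
by case=> xuy; [have : u \in `]x, y[ by []|have : u \in `]y, x[ by []];
  move=> /near_in_itvoo; apply: filterS => z; rewrite in_itv/=; [left|right].
Qed.

Lemma btw_mid x y : x != y -> btw x ((x + y) / 2)%R y.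
Proof.
rewrite neq_lt => /orP[xy|yx]; [left|right]; first by rewrite !midf_lt.
by rewrite addrC !midf_lt.
Qed.

Lemma is_interval_btwU1 x y : is_interval [set u | u = x \/ btw x u y].
Proof.
have H u v : btw x v y -> (x <= u <= v)%R \/ (v <= u <= x)%R -> u = x \/ btw x u y.
  have [->|ux] := eqVneq u x; first by left.
  case=> /andP[h1 h2] [] /andP[h3 h4]; right.
  - by left; rewrite lt_neqAle eq_sym ux h3 (le_lt_trans h4).
  - by have := lt_le_trans h1 (le_trans h3 h4); rewrite ltxx.
  - by have := le_lt_trans (le_trans h3 h4) h2; rewrite ltxx.
  - by right; rewrite (lt_le_trans h1)//= lt_neqAle ux h4.
move=> u v [->|xuy] [->|xvy] w /andP[uw wv] /=.
- by left; apply/eqP; rewrite eq_le wv uw.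
- by apply: (H _ v) => //; left; rewrite uw.
- by apply: (H _ u) => //; right; rewrite uw.
- by right; apply: (is_interval_btw xuy xvy); rewrite uw.
Qed.

Lemma component_extend c x y z : connected_component (Lambda2 X) c x ->
  (forall u, btw x u y -> Lambda2 X u) -> btw x z y ->
  connected_component (Lambda2 X) c z.
Proof.
move=> cx H xzy; rewrite (same_connected_component cx).
apply: (@connected_component_max _ _ [set u | u = x \/ btw x u y]); last by right.
- by left.
- by move=> u [->|/H//]; exact: connected_component_sub cx.
- by apply/connected_intervalP; exact: is_interval_btwU1.
Qed.

(** Since nearby regular points reach each other, the points of the component that reach [x] form a
    relatively open and closed subset, nonempty because of [c]. *)
Lemma component_reaches c x y : connected_component (Lambda2 X) c y ->
  reaches X c x -> reaches X y x.
Proof.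
move=> cy cx; set C := connected_component (Lambda2 X) c in cy *.
have oL (P : set R) : (forall u v, Lambda2 X u -> P u -> reaches X u v ->
    reaches X v u -> P v) -> open [set u | Lambda2 X u /\ P u].
  move=> HP; rewrite openE => u [L2u Pu].
  apply: filterS (Lambda2_near L2u) => v [L2v uv vu]; split=> //.
  exact: HP uv vu.
suff : C `&` [set u | reaches X u x] = C by move=> /seteqP[_ /(_ _ cy)[]].
apply: (@component_connected _ (Lambda2 X) c).
- exists c; split=> //; apply: connected_component_refl.
  by case: cy => B [Bc BL _] _; exact: BL.
- exists [set u | Lambda2 X u /\ reaches X u x].
    by apply: oL => u v _ ux _ vu; exact: reaches_trans vu ux.
  apply/seteqP; split=> u [Cu ux]; split=> //; last by case: ux.
  by split=> //; exact: connected_component_sub Cu.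
- exists (~` [set u | Lambda2 X u /\ ~ reaches X u x]).
    apply: open_closedC; apply: oL => u v _ ux uv _ vx.
    by apply: ux; exact: reaches_trans uv vx.
  apply/seteqP; split=> u [Cu ux]; split=> //; first by move=> [].
  apply: contrapT => nux; apply: ux; split=> //.
  exact: connected_component_sub Cu.
Qed.

(** The component is the one adjacent to [x] on side [s], found through [two_way]; it stops at [x],
    which is not regular. The third and fourth clauses say that it extends down to [x] and has no
    last point, which identifies it as an open interval with endpoint [x]. *)
Lemma shunt_component s x : s != 0%R -> e_side X s x = 1 -> e_side X (- s) x = 0 ->
  reaches X x x ->
  exists2 c, Lambda2 X c & let C := connected_component (Lambda2 X) c in
    [/\ forall u, C u -> side s x u, forall u, C u -> reaches X u x,
        forall u v, side s x u -> C v -> side s u v -> C u &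
        forall u, C u -> exists2 v, C v & side s u v].
Proof.
move=> s0 e1 e0 xx; have Ns0 : (- s != 0)%R by rewrite oppr_eq0.
have [y xy Hy] := two_way s0 e1 xx.
have xNy : x != y by apply/eqP => yx; move: xy; rewrite yx; exact: side_irr.
have xcy := btw_mid xNy; set c := ((x + y) / 2)%R in xcy.
have [xc cx L2c] := Hy _ xcy.
have nL2x : ~ Lambda2 X x.
  by move=> /(Lambda2E X x s0)[_]; rewrite e0 => /eqP; rewrite eq_sym onee_eq0.
exists c => //=; set C := connected_component _ c.
have Cc : C c by exact: connected_component_refl.
have segC u : btw x u y -> C u.
  move: u; apply: (@connected_component_max _ _ [set u | btw x u y]) => //.
    by move=> u /Hy[].
  by apply/connected_intervalP; exact: is_interval_btw.
have iC : is_interval C by apply/connected_intervalP; exact: component_connected.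
have btwC u v z : C u -> C z -> btw u v z -> C v.
  move=> Cu Cz [] /andP[/ltW h1 /ltW h2]; first by apply: (iC _ _ Cu Cz); rewrite h1.
  by apply: (iC _ _ Cz Cu); rewrite h1.
have nCx : ~ C x by move=> /connected_component_sub.
have [sxc scy] := btw_side s0 xy xcy.
split.
- move=> u Cu; have [ux|//|/sideN ux] := side_total x u s0.
    by move: nCx; rewrite -ux.
  by case: nCx; apply: (btwC u _ c) => //; exact: side_btw ux sxc.
- by move=> u Cu; exact: component_reaches Cu cx.
- move=> u v xu Cv uv; have [->//|cu|/sideN uc] := side_total c u s0.
    by apply: (btwC c _ v) => //; exact: side_btw cu uv.
  by apply: segC; apply: (side_btw s0 xu); exact: side_trans uc scy.
- move=> u Cu; have L2u := connected_component_sub Cu.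
  have [e1u _] := (Lambda2E X u s0).1 L2u.
  have [v uv Hv] := two_way s0 e1u (self_regular_reaches (Lambda2_self_regular L2u)).
  have uNv : u != v by apply/eqP => uv'; move: uv; rewrite uv'; exact: side_irr.
  have umv := btw_mid uNv; exists ((u + v) / 2)%R.
    by apply: component_extend umv => // z /Hv[].
  by case: (btw_side s0 uv umv).
Qed.

(** The singleton is its own Borel bound on both sides. No other point is regular for it, as a
    continuous path started elsewhere cannot be at [x] at arbitrarily small times. *)
Lemma thin_point x : ~ self_regular X x -> thin X [set x].
Proof.
move=> nx; exists [set x]; split=> //.
  move=> mu; exists [set x], [set x]; split=> //.
  exists set0; split; first by case: (natural_sigma_algebra X).
    by move=> w [t [_ [b []]]].
  by rewrite (eq_integral (cst 0)) ?integral0// => z _; exact: measure0.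
apply/seteqP; split=> // y /= [N [mN N0 HN]].
have [yx|yx] := eqVneq y x.
  apply: nx; rewrite -yx; have mx := measurable_hitting_eq0 X (good_point x).
  apply/eqP; rewrite eq_le probability_le1 ?yx//=.
  have := probability_setC (Prob X x) mN; rewrite -yx N0 sube0 => <-.
  rewrite yx; apply: le_measure; rewrite ?inE//; first exact: measurableC.
  by move=> w; apply: contra_notP; exact: HN.
have : Prob X y N = 1.
  apply/eqP; rewrite eq_le probability_le1//= -(law_start X (Some y)).
  apply: le_measure; rewrite ?inE//; first exact: measurable_start.
  move=> w X0; apply: HN => /= /hitting_eq0P xw.
  have [e e0 He] := path_cont (lexx 0%R) X0
    (open_nbhs_nbhs (conj (closed_openC (@closed_eq R x)) (elimN eqP yx))).
  have [t [t0 te [_ -> Xt]]] := xw _ e0; rewrite lte_fin in te.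
  have [|z zx] := He t (ltW t0); first by rewrite subr0 gtr0_norm.
  by rewrite -Xt => -[].
by rewrite N0 => /eqP; rewrite eq_sym onee_eq0.
Qed.

End Components.

(** * Self-regularity forced by (H) inside the classes *)

Section HuntHypothesis.
Context {R : realType} {d : measure_display} {Omega : measurableType d}.
Variable X : diffusion R Omega.
Implicit Types (B : set R) (s t u v x y z : R) (w : Omega).

Lemma polar_unreachable x y : polar X [set x] -> ~ reaches X y x.
Proof.
move=> [B [_ xB /(_ y) HB]] /reachesE; apply/negP; rewrite -leNgt.
rewrite [leLHS](_ : _ = 0)//; apply: measure_negligible; first exact: measurable_hits.
apply: negligibleS HB => w /= xw; apply/hits_fin; exact: hitsS xw.
Qed.

Lemma communicate_cross (P : set R) x y : communicate X x y -> P x -> ~ P y ->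
  exists u v, [/\ direct_comm X u v, P u & ~ P v].
Proof.
move=> [l]; elim: l x => [x _ /= -> //|u l IH x /= /andP[xu ul] lasty Px NPy].
have [Pu|NPu] := pselect (P u); first exact: IH ul lasty Pu NPy.
by exists x, u.
Qed.

(** A path from [v] to [u] would start at or pass through [x], from which side [s] is never
    entered. *)
Lemma no_crossing s x u v : s != 0%R -> e_side X s x = 0 -> side s x u ->
  ~ side s x v -> ~ reaches X v u.
Proof.
move=> s0 e0 xu nxv vu.
have nxu : ~ reaches X x u.
  by move=> /(reaches_e_side s0 xu); rewrite e0 => /eqP; rewrite eq_sym onee_eq0.
have [vx|//|/sideN vx] := side_total x v s0; first by apply: nxu; rewrite -vx.
by apply: nxu; case: (reaches_through (side_btw s0 vx xu) vu).
Qed.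

(** The class of [x] contains a point [y] on side [s], so some chain has a link joining side [s] to
    its complement. By [no_crossing] this link leads out of the side, and a path following it ends
    at [x] or passes through it. *)
Lemma inner_line_reached s x : s != 0%R -> e_side X s x = 0 ->
  inner_line X x -> exists y, reaches X y x.
Proof.
move=> s0 e0 [k _ intx].
have kx : communicate X k x := interior_subset intx.
have [e /= e0' He] := (nbhs_ballP _ _).1 intx.
have [m /(_ m (leqnn m)) yx] := approach_cvg s x e0'.
set y := approach s x m in yx.
have ky : communicate X k y by apply: He; rewrite /ball/= distrC.
have xy : side s x y.
  by rewrite /side/= /approach mulrDr ltrDl mulrA mulr_gt0// -expr2 exprn_even_gt0.
have [u [v [uv xu nxv]]] : exists u v,
    [/\ reaches X u v \/ reaches X v u, side s x u & ~ side s x v].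
  (* The base point [k] of the class may lie on either part: the chain used goes from [k] to [x] in
     one case and from [k] to [y] in the other. *)
  have [xk|nxk] := pselect (side s x k).
    have [u [v [/asboolP uv xu xv]]] := communicate_cross kx xk (@side_irr _ s x).
    by exists u, v.
  have [|u [v [/asboolP uv nxu xv]]] := communicate_cross (P := ~` side s x) ky nxk.
    by move=> /(_ xy).
  by exists v, u; split=> //; [case: uv => ?; [right|left]|exact: contrapT].
case: uv => [uv|/(no_crossing s0 e0 xu nxv)//]; exists u.
have [vx|xv|/sideN vx] := side_total x v s0.
- by rewrite -vx.
- by case: nxv.
- have Ns0 : (- s != 0)%R by rewrite oppr_eq0.
  have uxv : btw u x v by apply: (side_btw Ns0); exact/sideN.
  by case: (reaches_through uxv uv).
Qed.

Lemma hunt_self_regular s x : s != 0%R -> e_side X s x = 0 ->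
  hunt_H X -> inner_line X x -> self_regular X x.
Proof.
move=> s0 e0 HX inx; apply: contrapT => nx.
have [y yx] := inner_line_reached s0 e0 inx.
apply: polar_unreachable yx; apply: HX; exists (fun=> [set x]).
by split=> [_|z zx]; [exact: thin_point|exists 0%N].
Qed.

(** * Polarity of nearly Borel sets without regular points *)

Lemma nearly_borel_bigcup (B : (set R)^nat) :
  (forall n, nearly_borel X (B n)) -> nearly_borel X (\bigcup_n B n).
Proof.
move=> nB mu.
have /choice[F HF] : forall n, exists p : set R * set R * set Omega,
    [/\ measurable p.1.1, measurable p.1.2, p.1.1 `<=` B n, B n `<=` p.1.2 &
     [/\ natural_sigma X p.2,
      [set w | exists t : R, (0 <= t)%R /\ (Some @` (p.1.2 `\` p.1.1)) (X t w)]
        `<=` p.2 & \int[mu]_x law X x p.2 = 0]].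
  by move=> n; have [B1 [B2 [? ? ? ? [N ?]]]] := nB n mu; exists (B1, B2, N).
exists (\bigcup_n (F n).1.1), (\bigcup_n (F n).1.2); split.
- by apply: bigcupT_measurable => n; case: (HF n).
- by apply: bigcupT_measurable => n; case: (HF n).
- by apply: subset_bigcup => n _; case: (HF n).
- by apply: subset_bigcup => n _; case: (HF n).
have nN n : natural_sigma X (F n).2 by case: (HF n) => _ _ _ _ [].
have nU : natural_sigma X (\bigcup_n (F n).2).
  by have [_ _] := natural_sigma_algebra X; exact.
have mN n := natural_measurable (nN n).
exists (\bigcup_n (F n).2); split=> //.
- move=> w [t [t0 [b [[n _ Bn] nB1] Xt]]]; exists n => //.
  case: (HF n) => _ _ _ _ [_ + _]; apply; exists t; split=> //; exists b => //.
  by split=> // B1; apply: nB1; exists n.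
- apply/eqP; rewrite eq_le integral_ge0 ?andbT//.
  apply: (@le_trans _ _ (\int[mu]_x \sum_(n <oo) law X x (F n).2)).
    apply: ge0_le_integral => //.
    + exact: law_measurable.
    + apply: ge0_emeasurable_sum => // n _; exact: law_measurable.
    + move=> z _; apply: measure_sigma_subadditive => //.
      exact: natural_measurable nU.
  rewrite integral_nneseries//; last by move=> n; exact: law_measurable.
  by rewrite eseries0// => n _ _; case: (HF n) => _ _ _ _ [].
Qed.

Lemma polar_bigcup (A : set R) (B : (set R)^nat) :
  (forall n, nearly_borel X (B n)) -> A `<=` \bigcup_n B n ->
  (forall n x, (Prob X x).-negligible [set w | sigma X (B n) w < +oo]) ->
  polar X A.
Proof.
move=> nB AB H; exists (\bigcup_n B n); split=> //.
  exact: nearly_borel_bigcup.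
move=> x; apply: negligibleS (negligible_bigcup (fun n => H n x)) => w /=.
move=> /hits_fin[t [t0 ty [b [n _ Bb] Xt]]]; exists n => //=.
by apply/hits_fin; exists t; split=> //; exists b.
Qed.

Lemma regular_points_self_regular B x : regular_points X B = set0 -> B x ->
  ~ self_regular X x.
Proof.
move=> B0 Bx sx; suff : regular_points X B x by rewrite B0.
exists (~` [set w | sigma X [set x] w = 0]).
have mx := measurable_hitting_eq0 X (good_point x).
split; first exact: measurableC.
  by rewrite probability_setC// [Y in 1 - Y]sx subee.
move=> w; apply: contra_not => /hitting_eq0P xw; apply/hitting_eq0P => e /xw.
by apply: hitsS => // _ ->.
Qed.

Lemma shunt_unreachable s x y : s != 0%R -> e_side X s x = 1 ->
  e_side X (- s) x = 0 -> ~ self_regular X x -> ~ inner_line X x ->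
  ~ reaches X y x.
Proof.
move=> s0 e1 e0 nx ninx yx.
have noside z : side s x z -> ~ reaches X z x.
  by move=> xz zx; apply: nx; exact: self_regular_entrance xz zx.
have [yx'|/noside//|/sideN sy] := side_total x y s0.
  rewrite yx' in yx; have [z xz zx] := returns_from_side e1 yx.
  exact: noside zx.
have [z xz xrz] := reaches_beyond s0 e1.
apply: ninx; exists x => //.
have := btw_open (side_btw s0 sy xz); apply: filterS => u yuz.
have [ux|xu|/sideN ux] := side_total x u s0.
- by rewrite /= ux; exists [::].
- have [_ uz] := btw_side s0 (side_trans sy xz) yuz.
  exists [:: u] => //=; rewrite andbT; apply/asboolP; left.
  by case: (reaches_through (side_btw s0 xu uz) xrz).
- have [yu _] := btw_side s0 (side_trans sy xz) yuz.
  exists [:: u] => //=; rewrite andbT; apply/asboolP; right.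
  by case: (reaches_through (side_btw s0 yu ux) yx).
Qed.

(* Distinct points outside the inner line are the endpoints, on the side -s, of
   distinct nondegenerate classes; a rational q in the class picks it. *)
Definition marked_by s (q : rat) x : Prop :=
  [/\ ~ inner_line X x, side s x (ratr q) &
      forall u, btw x u (ratr q) -> reaches X x u].

Lemma marked_by_ex s x : s != 0%R -> e_side X s x = 1 -> ~ inner_line X x ->
  exists q, marked_by s q x.
Proof.
move=> s0 e1 ninx; have [z xz xrz] := reaches_beyond s0 e1.
have [q xqz] : exists q : rat, btw x (ratr q) z.
  have : x != z by apply/eqP => xz'; move: xz; rewrite xz'; exact: side_irr.
  by rewrite neq_lt => /orP[|] /rat_in_itvoo[q]; rewrite in_itv/=;
    exists q; [left|right].
have [xq qz] := btw_side s0 xz xqz; exists q; split=> // u xuq.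
have [xu uq] := btw_side s0 xq xuq.
by case: (reaches_through (side_btw s0 xu (side_trans uq qz)) xrz).
Qed.

(** If one of two points marked by [q] lay on side [s] of the other, the other would reach a whole
    neighbourhood of it, making it interior to a class. *)
Lemma marked_by_inj s q x y : s != 0%R ->
  marked_by s q x -> marked_by s q y -> y = x.
Proof.
move=> s0; have H u v : marked_by s q u -> marked_by s q v -> ~ side s u v.
  move=> [_ _ Hu] [ninv vq _] uv; apply: ninv; exists u => //.
  have := btw_open (side_btw s0 uv vq); apply: filterS => z /Hu uz.
  by exists [:: z] => //=; rewrite andbT; apply/asboolP; left.
by move=> Hx Hy; have [//|/(H _ _ Hx Hy)//|/sideN/(H _ _ Hy Hx)] := side_total x y s0.
Qed.

(** Traps and regular points are self-regular, and so, by hypothesis, are shunts in the inner line;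
    [B] therefore consists of shunts off the inner line, none of which is reachable. Being
    unreachable one by one suffices because rational marks make them countable. *)
Lemma regular_points_empty_negligible B y :
  (forall s x, s != 0%R -> inner_line X x -> e_side X s x = 1 ->
     e_side X (- s) x = 0 -> self_regular X x) ->
  regular_points X B = set0 -> (Prob X y).-negligible [set w | sigma X B w < +oo].
Proof.
move=> HI B0.
have n1 : (1 != 0 :> R)%R by exact: oner_neq0.
have Nn1 : (-1 != 0 :> R)%R by rewrite oppr_eq0.
pose D s := [set x | [/\ B x, e_side X s x = 1, e_side X (- s) x = 0 & ~ inner_line X x]].
have BD x : B x -> D 1%R x \/ D (-1)%R x.
  move=> Bx; have nx := regular_points_self_regular B0 Bx.
  have [p0|p1] := e_side01 X 1 x; have [m0|m1] := e_side01 X (-1) x.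
  - by case: nx; exact: trap_self_regular n1 p0 m0.
  - right; split; rewrite ?opprK// => inx; apply: nx.
    by apply: (HI (-1)%R); rewrite ?opprK.
  - by left; split=> // inx; apply: nx; exact: (HI 1%R).
  - by case: nx; apply: Lambda2_self_regular; exact/(Lambda2E X x n1).
have negD s : s != 0%R -> (Prob X y).-negligible
    [set w | exists2 x, D s x & hits X [set x] 0 +oo w].
  (* For each rational [q], at most one point of [D s] is marked by [q], so [N q] is contained in a
     single null hitting event. *)
  move=> s0; pose N q := [set w | exists2 x, D s x /\ marked_by s q x & hits X [set x] 0 +oo w].
  have -> : [set w | exists2 x, D s x & hits X [set x] 0 +oo w] =
      \bigcup_n oapp N set0 (unpickle n).
    apply/seteqP; split=> [w [x Dx xw]|w [n _]].
      have [_ e1 _ ninx] := Dx; have [q xq] := marked_by_ex s0 e1 ninx.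
      exists (pickle q); [exact: I|rewrite pickleK /=].
      by exists x.
    by case: (unpickle n) => //= q [x [Dx _] xw]; exists x.
  apply: negligible_bigcup => n; case: (unpickle n) => [q|] /=; last first.
    exact: negligible_set0.
  have [[x [Dx xq]]|nex] := pselect (exists x, D s x /\ marked_by s q x); last first.
    rewrite (_ : N q = set0); first exact: negligible_set0.
    by apply/seteqP; split=> // w [x Dx _]; apply: nex; exists x.
  apply: (@negligibleS _ _ _ _ (hits X [set x] 0 +oo)).
    by move=> w [z [_ zq]]; rewrite (marked_by_inj s0 xq zq).
  apply/negligibleP; first exact: measurable_hits.
  apply/eqP; rewrite eq_le measure_ge0 andbT leNgt; apply/negP => /reachesE.
  have [Bx e1 e0 ninx] := Dx; apply: shunt_unreachable e1 e0 _ ninx => //.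
  exact: regular_points_self_regular Bx.
apply: negligibleS (negligibleU (negD 1%R n1) (negD (-1)%R Nn1)) => w /=.
move=> /hits_fin[t [t0 ty [x Bx Xt]]].
have xw : hits X [set x] 0 +oo w by exists t; split=> //; exists x.
by have [Dx|Dx] := BD x Bx; [left|right]; exists x.
Qed.

Lemma self_regular_hunt :
  (forall s x, s != 0%R -> inner_line X x -> e_side X s x = 1 ->
     e_side X (- s) x = 0 -> self_regular X x) -> hunt_H X.
Proof.
move=> HI A [C [thC AC]]; have /choice[B HB] := thC.
apply: (@polar_bigcup _ B).
- by move=> n; case: (HB n).
- by move=> z /AC[n nC Cz]; exists n => //; case: (HB n) => _ + _; exact.
- move=> n y; apply: regular_points_empty_negligible => //.
  by case: (HB n).
Qed.

(** * Shunt points as endpoints of components of the regular set *)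

Lemma right_component x : e_plus X x = 1 -> e_minus X x = 0 -> reaches X x x ->
  exists a b : \bar R, [/\ Lambda2_component X a b, x%:E = a &
    forall y : R, a < y%:E < b -> reaches X y x].
Proof.
rewrite e_plusE e_minusE => e1 e0 xx.
have [c L2c /= [sC rC cC oC]] := shunt_component (oner_neq0 R) e1 e0 xx.
(* The right endpoint is the supremum taken in the extended line, so an unbounded component is
   covered; having no last point, the component excludes it. *)
have CE : connected_component (Lambda2 X) c =
    [set y | x%:E < y%:E < ereal_sup (EFin @` connected_component (Lambda2 X) c)].
  apply/seteqP; split=> y /=.
    move=> Cy; have := sC y Cy; rewrite side_gt0//= lte_fin => ->.
    have [v Cv] := oC y Cy; rewrite side_gt0//= => yv.
    by rewrite (@lt_le_trans _ _ v%:E) ?lte_fin//; apply: ereal_sup_ubound; exists v.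
  rewrite lte_fin => /andP[xy /ereal_sup_gt[_ [v Cv <-]]]; rewrite lte_fin => yv.
  by apply: cC Cv _; rewrite side_gt0.
exists x%:E, (ereal_sup (EFin @` connected_component (Lambda2 X) c)); split=> //.
  by exists c.
by move=> y xyb; apply: rC; rewrite CE.
Qed.

Lemma left_component x : e_plus X x = 0 -> e_minus X x = 1 -> reaches X x x ->
  exists a b : \bar R, [/\ Lambda2_component X a b, x%:E = b &
    forall y : R, a < y%:E < b -> reaches X y x].
Proof.
have Nn1 : (-1 != 0 :> R)%R by rewrite oppr_eq0 oner_eq0.
rewrite e_plusE e_minusE => e0 e1 xx.
have [|c L2c /= [sC rC cC oC]] := shunt_component Nn1 e1 _ xx; first by rewrite opprK.
have CE : connected_component (Lambda2 X) c =
    [set y | ereal_inf (EFin @` connected_component (Lambda2 X) c) < y%:E < x%:E].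
  apply/seteqP; split=> y /=.
    move=> Cy; have := sC y Cy; rewrite side_lt0 ?ltrN10//= lte_fin => ->.
    have [v Cv] := oC y Cy; rewrite side_lt0 ?ltrN10//= => vy.
    by rewrite andbT (@le_lt_trans _ _ v%:E) ?lte_fin//; apply: ereal_inf_lbound; exists v.
  rewrite lte_fin => /andP[/ereal_inf_lt[_ [v Cv <-]]]; rewrite lte_fin => vy yx.
  by apply: cC Cv _; rewrite side_lt0 ?ltrN10.
exists (ereal_inf (EFin @` connected_component (Lambda2 X) c)), x%:E; split=> //.
  by exists c.
by move=> y xyb; apply: rC; rewrite CE.
Qed.

Lemma component_nonempty (a b : \bar R) : Lambda2_component X a b ->
  exists c : R, a < c%:E < b.
Proof.
move=> [c L2c cE]; exists c; have := connected_component_refl L2c.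
by rewrite cE.
Qed.

End HuntHypothesis.

Theorem theorem1 (R : realType) (d : measure_display) (Omega : measurableType d)
    (X : diffusion R Omega) :
  no_killing_inside X ->
  (hunt_H X <->
   inner_line X `&` Lambda_pr X =
     [set x | (inner_line X `&` Lambda_pr X) x /\
        exists a b : \bar R, [/\ Lambda2_component X a b, x%:E = a &
          forall y : R, a < y%:E < b -> reaches X y x]]
   /\
   inner_line X `&` Lambda_pl X =
     [set x | (inner_line X `&` Lambda_pl X) x /\
        exists a b : \bar R, [/\ Lambda2_component X a b, x%:E = b &
          forall y : R, a < y%:E < b -> reaches X y x]]).
Proof.
move=> _; have n1 : (1 != 0 :> R)%R by exact: oner_neq0.
have Nn1 : (-1 != 0 :> R)%R by rewrite oppr_eq0.
split=> [HX|[/seteqP[Hr _] /seteqP[Hl _]]].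
  split; apply/seteqP; split=> [x [inx Lx]|x []//]; split=> //.
    have [em ep] := Lx; apply: right_component => //.
    apply: self_regular_reaches; apply: hunt_self_regular Nn1 _ HX inx.
    by rewrite -e_minusE.
  have [ep em] := Lx; apply: left_component => //.
  apply: self_regular_reaches; apply: hunt_self_regular n1 _ HX inx.
  by rewrite -e_plusE.
apply: self_regular_hunt => s x s0 inx e1 e0.
have Ns0 : (- s != 0)%R by rewrite oppr_eq0.
(* Any point of the component ending at [x] will do: it lies on the side that [x] enters and reaches
   [x], as [self_regular_entrance] requires. *)
have [c xc cx] : exists2 c, side s x c & reaches X c x.
  move: e1 e0; rewrite !e_side_sg// oppr_gt0.
  have [sn|sp|/eqP] := ltgtP s 0%R; last by rewrite (negbTE s0).
    move=> em ep; have [|_ [a [b [ab xb Hab]]]] := Hl x; first by split.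
    have [c acb] := component_nonempty ab; exists c; last exact: Hab.
    by case/andP: acb => _; rewrite -xb side_lt0//= lte_fin.
  move=> ep em; have [|_ [a [b [ab xa Hab]]]] := Hr x; first by split.
  have [c acb] := component_nonempty ab; exists c; last exact: Hab.
  by case/andP: acb => + _; rewrite -xa side_gt0//= lte_fin.
exact: self_regular_entrance e1 xc cx.
Qed.
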